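(* Let $\Bbbk$ be a commutative ring with identity, and let $L$ be a Lie algebra over $\Bbbk$ presented as $L=F/R$, with $F$ a free Lie algebra over $\Bbbk$ that is non-abelian and $R\neq 0$ a Lie ideal of $F$. Set $M=F\cap\varpi(F) R$ and $\widetilde L=F/M$. \begin{enumerate} \item[(i)] If $\bigcap_{n\ge1}\varpi^n(L)=0$, then $\bigcap_{n\ge1}\gamma_n(\widetilde L)=0$. \item[(ii)] If $\bigcap_{n\ge1}\gamma_n(\widetilde L)=0$ and the annihilator $\operatorname{ann}_{\mathscr U(L)}(R/M)$ is trivial, then $\bigcap_{n\ge1}\varpi^n(L)=0$. \item[(iii)] In particular, if $\mathscr U(L)$ is an integral domain (for example, if $\Bbbk$ is a field, so that $L$ is an algebra over a field), then $\bigcap_{n\ge1}\varpi^n(L)=0$ if and only if $\bigcap_{n\ge1}\gamma_n(\widetilde L)=0$. \end{enumerate}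
   Context: For a Lie algebra $L$ over $\Bbbk$: $\gamma_1(L)=L$ and $\gamma_{n+1}(L)$ is the $\Bbbk$-submodule generated by all $[x,y]$ with $x\in L$, $y\in\gamma_n(L)$; $\mathscr U(L)$ is the universal enveloping algebra over $\Bbbk$; $\varpi(L)$ is its augmentation ideal, i.e. the two-sided ideal generated by the image of $L$, and $\varpi^n(L)$ is its $n$th power. The free Lie algebra $F$ is viewed inside $\mathscr U(F)$. $\varpi(F)R$ is the $\Bbbk$-span of products of elements of $\varpi(F)$ and of $R$ in $\mathscr U(F)$; it equals $\varpi(F)\mathfrak r$, where $\mathfrak r=\mathscr U(F)R$ is the two-sided ideal of $\mathscr U(F)$ generated by $R$. One has $[R,R]\subseteq M\subseteq R$, and the right adjoint action of $F$ on $R$ (an element $y\in F$ acting by $x\mapsto[x,y]$) makes $R/M$ a right $\mathscr U(L)$-module; $\operatorname{ann}_{\mathscr U(L)}(R/M)$ is the annihilator for this action. ''Integral domain'' means a (possibly noncommutative) nonzero ring without zero divisors. *)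

(* Defs.v *)
From HB Require Import structures.
From mathcomp Require Import all_boot all_order all_algebra.
From mathcomp Require Import boolp classical_sets.

Set Implicit Arguments.
Unset Strict Implicit.
Unset Printing Implicit Defensive.

Import GRing.Theory.
Local Open Scope classical_set_scope.
Local Open Scope ring_scope.

HB.mixin Record Lmodule_isLie (K : comNzRingType) L of GRing.Lmodule K L := {
  lie : L -> L -> L;
  lie_linearl : forall y : L, linear (fun x => lie x y);
  lie_linearr : forall x : L, linear (fun y => lie x y);
  lie_alt : forall x : L, lie x x = 0;
  lie_jacobi : forall x y z : L,
    lie x (lie y z) + lie y (lie z x) + lie z (lie x y) = 0
}.

#[short(type="lieType")]
HB.structure Definition Lie (K : comNzRingType) :=
  {L of Lmodule_isLie K L & GRing.Lmodule K L}.

Section Submodules.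
Variables (K : comNzRingType) (V : lmodType K).

Definition submodule (N : set V) : Prop :=
  N 0 /\ forall (a : K) (x y : V), N x -> N y -> N (a *: x + y).

Definition kspan (S : set V) : set V := smallest submodule S.

End Submodules.

Section Lie.
Variable K : comNzRingType.

Definition lie_ideal (L : lieType K) (I : set L) : Prop :=
  submodule I /\ forall x y : L, I y -> I (lie x y).

Definition lie_morphism (L L' : lieType K) (f : {linear L -> L'}) : Prop :=
  forall x y : L, f (lie x y) = lie (f x) (f y).

(* [q] is the projection of [L] onto [Q] = [L / I]. *)
Definition lie_quotient (L Q : lieType K) (I : set L) (q : {linear L -> Q}) :
    Prop :=
  [/\ lie_morphism q, range q = setT & forall x : L, q x = 0 <-> I x].

Definition free_on (L : lieType K) (X : Type) (j : X -> L) : Prop :=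
  forall (L' : lieType K) (h : X -> L'),
    exists f : {linear L -> L'},
      [/\ lie_morphism f, forall t : X, f (j t) = h t
        & forall f' : {linear L -> L'},
            lie_morphism f' -> (forall t : X, f' (j t) = h t) -> f' =1 f].

Definition free_lie (L : lieType K) : Prop :=
  exists (X : Type) (j : X -> L), free_on j.

Definition abelian_lie (L : lieType K) : Prop :=
  forall x y : L, lie x y = 0.

(* [lower_central n] is gamma_n for n >= 1; the value at 0 is a dummy. *)
Fixpoint lower_central (L : lieType K) (n : nat) : set L :=
  match n with
  | S (S _ as m) =>
      kspan [set lie x y | x in setT & y in @lower_central L m]
  | _ => setT
  end.

End Lie.

Arguments lower_central [K] L n.

Section Enveloping.
Variable K : comNzRingType.

(* Morphisms from a Lie algebra to an associative algebra with the commutator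
   bracket. *)
Definition lie_to_assoc (L : lieType K) (A : algType K) (f : {linear L -> A}) :
    Prop :=
  forall x y : L, f (lie x y) = f x * f y - f y * f x.

(* [U], with the canonical map [i], is the universal enveloping algebra of
   [L]. *)
Definition enveloping (L : lieType K) (U : algType K) (i : {linear L -> U}) :
    Prop :=
  lie_to_assoc i /\
  forall (A : algType K) (f : {linear L -> A}), lie_to_assoc f ->
    exists g : {lrmorphism U -> A},
      (forall x : L, g (i x) = f x) /\
      forall g' : {lrmorphism U -> A}, (forall x : L, g' (i x) = f x) -> g' =1 g.

Definition ideal2 (A : algType K) (I : set A) : Prop :=
  [/\ I 0, forall x y : A, I x -> I y -> I (x + y)
    & forall a x : A, I x -> I (a * x) /\ I (x * a)].

Definition mulspan (A : algType K) (S T : set A) : set A :=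
  kspan [set x * y | x in S & y in T].

Fixpoint idealX (A : algType K) (I : set A) (n : nat) : set A :=
  match n with
  | 0 => setT
  | 1 => I
  | S m => mulspan I (idealX I m)
  end.

Definition augmentation (L : lieType K) (U : algType K) (i : {linear L -> U}) :
    set U :=
  smallest (@ideal2 U) (range i).

End Enveloping.

Section Adjoint.
Variables (K : comNzRingType) (F L Lt : lieType K).

(* M = F \cap varpi(F) R, where F is mapped to its enveloping algebra U by i. *)
Definition Mset (U : algType K) (i : {linear F -> U}) (R : set F) : set F :=
  i @^-1` mulspan (augmentation i) (i @` R).

(* [V] is the right U-module R/M, U being the enveloping algebra of L = F/R:
   a right U-module is a left module over the converse ring [U^c].  The map [e]
   identifies [V] with the image R/M of R in Lt = F/M, and the class of y in F
   acts on [V] by x |-> [x, y]; this determines the action, as the image of L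
   generates U. *)
Definition adjoint_module (U : algType K) (i : {linear L -> U})
    (p : {linear F -> L}) (q : {linear F -> Lt}) (R : set F)
    (V : lmodType U^c) (e : {additive V -> Lt}) : Prop :=
  [/\ injective e,
      range e = q @` R,
      forall (a : K) (v : V), e (((a%:A : U) : U^c) *: v) = a *: e v
    & forall (y : F) (v : V), e ((i (p y) : U^c) *: v) = lie (e v) (q y)].

End Adjoint.

Definition annihilator (A : pzRingType) (V : lmodType A) : set A :=
  [set u | forall v : V, u *: v = 0].

(* Main.v *)
Require Import Defs.
From HB Require Import structures.
From mathcomp Require Import all_boot all_order all_algebra.
From mathcomp Require Import finmap monalg.
From mathcomp Require Import boolp classical_sets wochoice.

Set Implicit Arguments.
Unset Strict Implicit.
Unset Printing Implicit Defensive.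

Import GRing.Theory.
Local Open Scope classical_set_scope.
Local Open Scope ring_scope.

(** Write U(F) and U(L) for the enveloping algebras, varpi for augmentation
    ideals, J = U(F) R and Q = varpi(F) R, so that M is the preimage of Q in F.

    As F is free on X, U(F) is the free associative algebra on X, and varpi(F) is
    the free right U(F)-module on X; the coordinates are the Fox derivatives
    [fox_derivative].  Since J is the kernel of U(F) -> U(L) ([enveloping_ker])
    and Q = varpi(F) J, an element of varpi(F) lies in Q exactly when its Fox
    derivatives vanish in U(L) ([aug_rel_foxP]).  This is the Magnus embedding of
    F/M, and of R/M as a right U(L)-module, into the free right U(L)-module on X.

    (i) The n-th term of the lower central series of F maps into varpi(F)^n,
    whose elements have their derivatives in varpi(F)^(n-1).  So the coordinates
    of an element of every lower central term of F/M lie in every power of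
    varpi(L) ([residual_lower_central]).

    (ii) An element of varpi(L)^n sends R/M into the (n+1)-st lower central term
    of F/M, because a letter of L acts by a bracket ([adjoint_lower_central]).
    If these terms intersect in zero, an element of all the powers of varpi(L)
    annihilates R/M.

    (iii) When U(L) is a domain, a nonzero element of R/M has zero annihilator,
    since it sits in a free module, so (ii) applies unless R = M.  In that case R
    maps into every power of varpi(F); these have zero intersection
    ([free_augmentation_residual]), so U(L) = U(F) and the powers of varpi(L)
    intersect in zero as well ([residual_augmentation]).

    Over a field, U(L) is a domain by the Poincare-Birkhoff-Witt theorem.  Choose
    an ordered basis of L and let S be the polynomial ring on it.  An action of L
    on S in which each basis vector is multiplication by its variable up to lower
    degree ([pbw_action_exists]) makes u |-> u.1 an injection of U(L) into S, with
    ordered products as inverse ([quantize_rep1]).  It is multiplicative up to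
    lower degree ([rep_quantize]), so the leading coefficient of a product is the
    product of the leading coefficients ([enveloping_domain]).

    Universal properties are turned into statements about elements by comparing
    representations: [intertwine] shows that a linear map commuting with
    generators commutes with the algebra they generate. *)

(** * Submodules, quotients and endomorphism algebras *)

Section Submodules.
Variables (K : comNzRingType) (V : lmodType K).
Implicit Types (N S : set V) (u v : V).

Lemma submod0 N : submodule N -> N 0. Proof. by case. Qed.

Lemma submodD N u v : submodule N -> N u -> N v -> N (u + v).
Proof. by case=> _ Nl Nu Nv; rewrite -[u]scale1r; exact: Nl. Qed.

Lemma submodZ N (a : K) u : submodule N -> N u -> N (a *: u).
Proof. by case=> N0 Nl Nu; rewrite -[_ *: _]addr0; exact: Nl. Qed.

Lemma submodN N u : submodule N -> N u -> N (- u).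
Proof. by move=> sN Nu; rewrite -scaleN1r; exact: submodZ. Qed.

Lemma submodB N u v : submodule N -> N u -> N v -> N (u - v).
Proof. by move=> sN Nu Nv; apply: submodD => //; exact: submodN. Qed.

Lemma submodBC N u v : submodule N -> N (u - v) -> N (v - u).
Proof. by move=> sN Nuv; rewrite -opprB; exact: submodN. Qed.

Lemma submod_trans N u v w :
  submodule N -> N (u - v) -> N (v - w) -> N (u - w).
Proof. by move=> sN Nuv Nvw; rewrite -(subrKA v); exact: submodD. Qed.

Lemma kspan_submod S : submodule (kspan S).
Proof.
split=> [N [] sN _|a u v Su Sv N [sN SN]]; first exact: submod0.
by apply: submodD => //; [apply: submodZ => //; exact: Su|exact: Sv].
Qed.

Lemma kspan_gen S : S `<=` kspan S.
Proof. exact: sub_gen_smallest. Qed.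

Lemma kspan_ind S N : submodule N -> S `<=` N -> kspan S `<=` N.
Proof. exact: smallest_sub. Qed.

End Submodules.

Section LinearPreimage.
Variables (K : comNzRingType) (V W : lmodType K).

Lemma submod_preim (f : {linear V -> W}) (N : set W) :
  submodule N -> submodule (f @^-1` N).
Proof.
move=> sN; split=> [|a u v]; rewrite /preimage /= ?linear0; first exact: submod0.
by move=> Nu Nv; rewrite linearP; apply: submodD => //; exact: submodZ.
Qed.

Lemma submod_ker (f : {linear V -> W}) : submodule [set v | f v = 0].
Proof.
by split=> [|a u v /= fu fv]; rewrite /= ?linear0 // linearP fu fv scaler0 addr0.
Qed.

Lemma submod_eq (f g : {linear V -> W}) : submodule [set v | f v = g v].
Proof.
by split=> [|a u v /= fu fv]; rewrite /= ?linear0 // !linearP fu fv.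
Qed.

Lemma submod_im (f : {linear V -> W}) (N : set V) :
  submodule N -> submodule (f @` N).
Proof.
move=> sN; split=> [|a _ _ [u Nu <-] [v Nv <-]].
  by exists 0; rewrite ?linear0 //; exact: submod0.
exists (a *: u + v); last by rewrite linearP.
by apply: submodD => //; exact: submodZ.
Qed.

End LinearPreimage.

Section Quotient.
Variables (K : comNzRingType) (V : lmodType K) (N : set V).
Hypothesis sN : submodule N.

Definition qrep (v : V) : V := xget 0 [set u | N (v - u)].

Lemma qrepP v : N (v - qrep v).
Proof.
rewrite /qrep; case: xgetP => [u _ //|/(_ v)] [] /=.
by rewrite subrr; exact: submod0.
Qed.

Lemma qrep_eq u v : N (u - v) -> qrep u = qrep v.
Proof.
move=> Nuv; congr (xget 0 _); apply/predeqP => w /=; split=> Nw.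
  by apply: submod_trans Nw => //; exact: submodBC.
by apply: submod_trans Nw.
Qed.

Lemma qrepK v : qrep (qrep v) = qrep v.
Proof. by apply: qrep_eq; apply: submodBC => //; exact: qrepP. Qed.

(** The quotient module [V / N], carried by one chosen vector in each coset.
    The proof [sN] is kept as a parameter because the module structure can only
    be inferred from the type if the type determines it. *)
Definition quot : Type := let _ := sN in {v : V | qrep v = v}.
HB.instance Definition _ := gen_eqMixin quot.
HB.instance Definition _ := gen_choiceMixin quot.

Definition qpi v : quot := exist _ (qrep v) (qrepK v).

Lemma qpi_surj (x : quot) : exists v, x = qpi v.
Proof.
case: x => v hv; exists v; rewrite /qpi; move: (qrepK v); rewrite hv => hv'.
by congr exist; exact: Prop_irrelevance.
Qed.

Lemma qpi_eqP u v : qpi u = qpi v <-> N (u - v).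
Proof.
split=> [[uv]|/qrep_eq uv].
  apply: (@submod_trans _ _ _ _ (qrep u)) (qrepP u) _ => //.
  by rewrite uv; apply: submodBC => //; exact: qrepP.
rewrite /qpi; move: (qrepK u) (qrepK v); rewrite uv => hu hv.
by congr exist; exact: Prop_irrelevance.
Qed.

Definition qval (x : quot) : V := sval x.

Definition qadd x y := qpi (qval x + qval y).
Definition qopp x := qpi (- qval x).
Definition qscale (a : K) x := qpi (a *: qval x).

Lemma qaddE u v : qadd (qpi u) (qpi v) = qpi (u + v).
Proof.
apply/qpi_eqP; rewrite opprD addrACA.
by apply: submodD => //; apply: submodBC => //; exact: qrepP.
Qed.

Lemma qscaleE a u : qscale a (qpi u) = qpi (a *: u).
Proof.
apply/qpi_eqP; rewrite -scalerBr.
by apply: submodZ => //; apply: submodBC => //; exact: qrepP.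
Qed.

Lemma qoppE u : qopp (qpi u) = qpi (- u).
Proof. by rewrite /qopp -!scaleN1r; exact: qscaleE. Qed.

Fact qaddA : associative qadd.
Proof.
move=> x y z; have [u ->] := qpi_surj x; have [v ->] := qpi_surj y.
by have [w ->] := qpi_surj z; rewrite !qaddE addrA.
Qed.

Fact qaddC : commutative qadd.
Proof. by move=> x y; rewrite /qadd addrC. Qed.

Fact qadd0 : left_id (qpi 0) qadd.
Proof. by move=> x; have [u ->] := qpi_surj x; rewrite qaddE add0r. Qed.

Fact qaddN : left_inverse (qpi 0) qopp qadd.
Proof. by move=> x; have [u ->] := qpi_surj x; rewrite qoppE qaddE addNr. Qed.

HB.instance Definition _ := GRing.isZmodule.Build quot qaddA qaddC qadd0 qaddN.

Fact qpiD u v : qpi u + qpi v = qpi (u + v).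
Proof. exact: qaddE. Qed.

Fact qscaleA a b x : qscale a (qscale b x) = qscale (a * b) x.
Proof. by have [u ->] := qpi_surj x; rewrite !qscaleE scalerA. Qed.

Fact qscale1 : left_id 1 qscale.
Proof. by move=> x; have [u ->] := qpi_surj x; rewrite !qscaleE scale1r. Qed.

Fact qscaleDr : right_distributive qscale +%R.
Proof.
move=> a x y; have [u ->] := qpi_surj x; have [v ->] := qpi_surj y.
by rewrite !(qscaleE, qpiD) scalerDr.
Qed.

Fact qscaleDl x : {morph qscale^~ x : a b / a + b}.
Proof.
move=> a b; have [u ->] := qpi_surj x.
by rewrite !(qscaleE, qpiD) scalerDl.
Qed.

HB.instance Definition _ :=
  GRing.Zmodule_isLmodule.Build K quot qscaleA qscale1 qscaleDr qscaleDl.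

Fact qpi_linear : linear qpi.
Proof. by move=> a u v; rewrite -qaddE -qscaleE. Qed.

HB.instance Definition _ := GRing.isLinear.Build K V quot _ qpi qpi_linear.

Definition qmap (f : V -> V) (x : quot) : quot := qpi (f (qval x)).

Lemma qmapE (f : {linear V -> V}) v :
  (forall u, N u -> N (f u)) -> qmap f (qpi v) = qpi (f v).
Proof.
move=> fN; apply/qpi_eqP; rewrite -linearB; apply: fN.
by apply: submodBC => //; exact: qrepP.
Qed.

Lemma qmap_linear (f : {linear V -> V}) :
  (forall u, N u -> N (f u)) -> linear (qmap f).
Proof.
move=> fN a x y; have [u ->] := qpi_surj x; have [v ->] := qpi_surj y.
by rewrite -linearP !qmapE // !linearP.
Qed.

End Quotient.
Arguments qmap {K V N} sN f x.

Section Endomorphisms.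
Variables (K : comNzRingType) (V : lmodType K).

(** The algebra K x End(V).  The factor K keeps it a nonzero ring when V = 0,
    as algebras are required to be: the quotient modules to which it is applied
    below may well vanish. *)
Record endo := Endo { endo_aug : K; endo_fun : V -> V; _ : linear endo_fun }.

HB.instance Definition _ := gen_eqMixin endo.
HB.instance Definition _ := gen_choiceMixin endo.

Lemma endo_linear (e : endo) : linear (endo_fun e).
Proof. by case: e. Qed.

HB.instance Definition _ e :=
  GRing.isLinear.Build K V V _ (endo_fun e) (endo_linear e).

Lemma endo_eq (e f : endo) :
  endo_aug e = endo_aug f -> endo_fun e =1 endo_fun f -> e = f.
Proof.
case: e f => [a e el] [b f fl] /= <- /funext ef; case: _ / ef in fl *.
by congr Endo; exact: Prop_irrelevance.
Qed.

Fact endo0_linear : linear (fun _ : V => 0 : V).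
Proof. by move=> a u v; rewrite scaler0 addr0. Qed.
Fact endo1_linear : linear (fun v : V => v).
Proof. by []. Qed.
Fact endoD_linear (e f : endo) : linear (fun v => endo_fun e v + endo_fun f v).
Proof. by move=> a u v; rewrite !linearP scalerDr addrACA. Qed.
Fact endoN_linear (e : endo) : linear (fun v => - endo_fun e v).
Proof. by move=> a u v; rewrite linearP opprD scalerN. Qed.
Fact endoM_linear (e f : endo) : linear (fun v => endo_fun e (endo_fun f v)).
Proof. by move=> a u v; rewrite !linearP. Qed.
Fact endoZ_linear (a : K) (e : endo) : linear (fun v => a *: endo_fun e v).
Proof. by move=> b u v; rewrite linearP scalerDr !scalerA mulrC. Qed.

Definition endo0 := Endo 0 endo0_linear.
Definition endo1 := Endo 1 endo1_linear.
Definition endo_add e f := Endo (endo_aug e + endo_aug f) (endoD_linear e f).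
Definition endo_opp e := Endo (- endo_aug e) (endoN_linear e).
Definition endo_mul e f := Endo (endo_aug e * endo_aug f) (endoM_linear e f).
Definition endo_scale a e := Endo (a * endo_aug e) (endoZ_linear a e).

Fact endo_addA : associative endo_add.
Proof. by move=> e f g; apply: endo_eq => [|v] /=; rewrite addrA. Qed.
Fact endo_addC : commutative endo_add.
Proof. by move=> e f; apply: endo_eq => [|v] /=; rewrite addrC. Qed.
Fact endo_add0 : left_id endo0 endo_add.
Proof. by move=> e; apply: endo_eq => [|v] /=; rewrite add0r. Qed.
Fact endo_addN : left_inverse endo0 endo_opp endo_add.
Proof. by move=> e; apply: endo_eq => [|v] /=; rewrite addNr. Qed.

HB.instance Definition _ :=
  GRing.isZmodule.Build endo endo_addA endo_addC endo_add0 endo_addN.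

Fact endo_mulA : associative endo_mul.
Proof. by move=> e f g; apply: endo_eq => [|v] //=; rewrite mulrA. Qed.
Fact endo_mul1 : left_id endo1 endo_mul.
Proof. by move=> e; apply: endo_eq => [|v] //=; rewrite mul1r. Qed.
Fact endo_1mul : right_id endo1 endo_mul.
Proof. by move=> e; apply: endo_eq => [|v] //=; rewrite mulr1. Qed.
Fact endo_mulDl : left_distributive endo_mul +%R.
Proof. by move=> e f g; apply: endo_eq => [|v] //=; rewrite mulrDl. Qed.
Fact endo_mulDr : right_distributive endo_mul +%R.
Proof.
by move=> e f g; apply: endo_eq => [|v] /=; [rewrite mulrDr|rewrite linearD].
Qed.
Fact endo1_neq0 : endo1 != 0.
Proof. by apply/eqP => -[/eqP]; rewrite oner_eq0. Qed.

HB.instance Definition _ := GRing.Zmodule_isNzRing.Build endo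
  endo_mulA endo_mul1 endo_1mul endo_mulDl endo_mulDr endo1_neq0.

Fact endo_scaleA a b e : endo_scale a (endo_scale b e) = endo_scale (a * b) e.
Proof. by apply: endo_eq => [|v] /=; [rewrite mulrA|rewrite scalerA]. Qed.
Fact endo_scale1 : left_id 1 endo_scale.
Proof. by move=> e; apply: endo_eq => [|v] /=; rewrite ?mul1r ?scale1r. Qed.
Fact endo_scaleDr : right_distributive endo_scale +%R.
Proof. by move=> a e f; apply: endo_eq => [|v] /=; rewrite ?mulrDr ?scalerDr. Qed.
Fact endo_scaleDl e : {morph endo_scale^~ e : a b / a + b}.
Proof. by move=> a b; apply: endo_eq => [|v] /=; rewrite ?mulrDl ?scalerDl. Qed.

HB.instance Definition _ := GRing.Zmodule_isLmodule.Build K endo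
  endo_scaleA endo_scale1 endo_scaleDr endo_scaleDl.

Fact endo_scaleAl a (e f : endo) : a *: (e * f) = (a *: e) * f.
Proof. by apply: endo_eq => [|v] //=; rewrite mulrA. Qed.
HB.instance Definition _ := GRing.Lmodule_isLalgebra.Build K endo endo_scaleAl.

Fact endo_scaleAr a (e f : endo) : a *: (e * f) = e * (a *: f).
Proof. by apply: endo_eq => [|v] /=; [rewrite mulrCA|rewrite linearZ]. Qed.
HB.instance Definition _ := GRing.Lalgebra_isAlgebra.Build K endo endo_scaleAr.

End Endomorphisms.

(** * Representations of enveloping algebras *)

Lemma jacobi_cancel (V : zmodType) (a b c d e f : V) :
  a - b + (f - d) + (d - c + (b - e)) + (e - f + (c - a)) = 0.
Proof.
rewrite [LHS](AC ((2*2)*(2*2)*(2*2))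
  ((1*12)*(2*7)*(3*10)*(4*5)*(6*11)*(8*9)))%AC /=.
by rewrite !subrr !addNr !addr0.
Qed.

Section CommutatorLie.
Variables (K : comNzRingType) (A : algType K).

(** A copy of [A], so that the bracket is attached to the copy only. *)
Definition comm_lie : Type := A.
HB.instance Definition _ := GRing.Lmodule.on comm_lie.

Definition commutator (x y : comm_lie) : comm_lie := (x : A) * y - (y : A) * x.

Fact commutator_linearl (y : comm_lie) : linear (commutator^~ y).
Proof.
move=> a u v; rewrite /commutator mulrDl mulrDr opprD -scalerAl -scalerAr.
by rewrite addrACA -scalerBr.
Qed.

Fact commutator_linearr (x : comm_lie) : linear (commutator x).
Proof.
move=> a u v; rewrite /commutator mulrDl mulrDr opprD -scalerAl -scalerAr.
by rewrite addrACA -scalerBr.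
Qed.

Fact commutator_alt (x : comm_lie) : commutator x x = 0.
Proof. exact: subrr. Qed.

Fact commutator_jacobi (x y z : comm_lie) :
  commutator x (commutator y z) + commutator y (commutator z x)
    + commutator z (commutator x y) = 0.
Proof.
rewrite /commutator !(mulrBl, mulrBr) !mulrA !opprB.
exact: jacobi_cancel.
Qed.

HB.instance Definition _ := Lmodule_isLie.Build K comm_lie
  commutator_linearl commutator_linearr commutator_alt commutator_jacobi.

End CommutatorLie.

Section LieTheory.
Variables (K : comNzRingType) (L : lieType K).
Implicit Types x y : L.

HB.instance Definition _ x :=
  GRing.isLinear.Build K L L _ (@lie K L x) (lie_linearr x).

Lemma lieDl x y z : lie (x + y) z = lie x z + lie y z.
Proof. by rewrite -[x]scale1r lie_linearl !scale1r. Qed.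

Lemma lieC x y : lie x y = - lie y x.
Proof.
apply/eqP; rewrite -addr_eq0; apply/eqP.
by have := lie_alt (x + y); rewrite lieDl !linearD /= !lie_alt add0r addr0.
Qed.

End LieTheory.

Definition representation (K : comNzRingType) (A : algType K) (V : lmodType K)
    (r : A -> V -> V) : Prop :=
  [/\ forall a, linear (r a), forall v, linear (r^~ v), forall v, r 1 v = v
    & forall a b v, r (a * b) v = r a (r b v)].

Section Representations.
Variables (K : comNzRingType) (A : algType K).

Lemma repD (V : lmodType K) (r : A -> V -> V) a (u v : V) :
  representation r -> r a (u + v) = r a u + r a v.
Proof. by case=> rl _ _ _; rewrite -[u]scale1r rl !scale1r. Qed.

Lemma rep0 (V : lmodType K) (r : A -> V -> V) a : representation r -> r a 0 = 0.
Proof. by move=> rr; apply: (addIr (r a 0)); rewrite -repD // !add0r. Qed.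

Lemma rep0l (V : lmodType K) (r : A -> V -> V) v :
  representation r -> r 0 v = 0.
Proof.
case=> _ rl _ _; have := rl v (-1) 0 0.
by rewrite scaler0 addr0 scaleN1r addNr.
Qed.

Definition lmul (a : A) (b : A) := a * b.

Fact lmul_linear a : linear (lmul a).
Proof. by move=> b u v; rewrite /lmul mulrDr -scalerAr. Qed.

HB.instance Definition _ a :=
  GRing.isLinear.Build K A A _ (lmul a) (lmul_linear a).

Lemma regular_rep : representation lmul.
Proof.
split=> [a|v a u w|v|a b v]; first exact: lmul_linear.
- by rewrite /lmul mulrDl -scalerAl.
- exact: mul1r.
- by rewrite /lmul mulrA.
Qed.

Lemma hom_rep (V : lmodType K) (f : {lrmorphism A -> endo V}) :
  representation (fun a => endo_fun (f a)).
Proof.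
split=> [a|v a b c|v|a b v].
- exact: linearP.
- by rewrite linearP.
- by rewrite rmorph1.
- by rewrite rmorphM.
Qed.

Lemma comp_rep (B : algType K) (f : {lrmorphism A -> B}) (V : lmodType K)
    (r : B -> V -> V) : representation r -> representation (fun a => r (f a)).
Proof.
case=> rl rr r1 rM; split=> [a|v a b c|v|a b v]; first exact: rl.
- by rewrite linearP rr.
- by rewrite rmorph1 r1.
- by rewrite rmorphM rM.
Qed.

End Representations.

Section Generators.
Variables (K : comNzRingType) (A : algType K) (T : Type) (g : T -> A).

(** The family [g] is an epimorphic set of generators: this is all that a
    universal property gives directly.  Actual generation is recovered in
    [dense_generates]. *)
Definition dense : Prop := forall (B : algType K) (f f' : {lrmorphism A -> B}),
  (forall x, f (g x) = f' (g x)) -> f =1 f'.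

Variables (eps : {lrmorphism A -> K^o}).
Hypothesis gd : dense.

Section Intertwine.
Variables (V W : lmodType K) (r : A -> V -> V) (s : A -> W -> W).
Hypotheses (rr : representation r) (sr : representation s).
Variable t : {linear V -> W}.

(* The second action is the first one conjugated by the shear
   (v, w) |-> (v, w + t v); the two agree exactly where [t] intertwines. *)
Let diag a (p : V * W) : V * W := (r a p.1, s a p.2).
Let shear a (p : V * W) : V * W := (r a p.1, s a (p.2 - t p.1) + t (r a p.1)).

Let diag_linear a : linear (diag a).
Proof.
case: rr sr => rl _ _ _ [sl _ _ _] b [v w] [v' w'].
by rewrite /diag /= rl sl.
Qed.

Let shear_linear a : linear (shear a).
Proof.
case: rr sr => rl _ _ _ [sl _ _ _] b [v w] [v' w'].
rewrite /shear /= linearP opprD addrACA -scalerBr rl sl linearP /= addrACA.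
by rewrite -scalerDr.
Qed.

Let diag_hom a : @endo K (V * W)%type :=
  @Endo K (V * W)%type (eps a : K) _ (diag_linear a).
Let shear_hom a : @endo K (V * W)%type :=
  @Endo K (V * W)%type (eps a : K) _ (shear_linear a).

Fact diag_hom_linear : linear diag_hom.
Proof.
case: rr sr => _ rl _ _ [_ sl _ _] a b c; apply: endo_eq => [|[v w]] /=.
  by rewrite linearP.
by rewrite /diag /= rl sl.
Qed.

Fact diag_hom_mul : multiplicative diag_hom.
Proof.
case: rr sr => _ _ r1 rM [_ _ s1 sM]; split=> [a b|].
  by apply: endo_eq => [|[v w]] /=; rewrite ?rmorphM // /diag /= rM sM.
by apply: endo_eq => [|[v w]] /=; rewrite ?rmorph1 // /diag /= r1 s1.
Qed.

Fact shear_hom_linear : linear shear_hom.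
Proof.
case: rr sr => _ rl _ _ [_ sl _ _] a b c; apply: endo_eq => [|[v w]] /=.
  by rewrite linearP.
by rewrite /shear /= rl sl linearP /= addrACA -scalerDr.
Qed.

Fact shear_hom_mul : multiplicative shear_hom.
Proof.
case: rr sr => _ _ r1 rM [_ _ s1 sM]; split=> [a b|].
  by apply: endo_eq => [|[v w]] /=; rewrite ?rmorphM // /shear /= rM sM addrK.
by apply: endo_eq => [|[v w]] /=; rewrite ?rmorph1 // /shear /= r1 s1 subrK.
Qed.

HB.instance Definition _ :=
  GRing.isLinear.Build K A (@endo K (V * W)%type) _ diag_hom diag_hom_linear.
HB.instance Definition _ :=
  GRing.isMultiplicative.Build A (@endo K (V * W)%type) diag_hom diag_hom_mul.
HB.instance Definition _ :=
  GRing.isLinear.Build K A (@endo K (V * W)%type) _ shear_hom shear_hom_linear.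
HB.instance Definition _ :=
  GRing.isMultiplicative.Build A (@endo K (V * W)%type) shear_hom shear_hom_mul.

(** The diagonal action on V x W and its conjugate by a shear are homomorphisms
    out of [A]; they agree on the generators, hence everywhere. *)
Lemma intertwine :
  (forall x v, t (r (g x) v) = s (g x) (t v)) ->
  forall a v, t (r a v) = s a (t v).
Proof.
move=> tg a v; have [sl _ _ _] := sr.
have : diag_hom a = shear_hom a.
  apply: gd => x; apply: endo_eq => // -[u w] /=.
  by rewrite /diag /shear /= tg -repD // subrK.
move=> /(congr1 (fun e => (endo_fun e (v, t v)).2)) /=.
by rewrite subrr rep0 // add0r.
Qed.

End Intertwine.

(** If left multiplication by the generators makes [A / N] a representation in
    which the projection intertwines, then [a] sends the class of 1 to the class
    of [a]; that class is zero as soon as [N] contains 1. *)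
Lemma dense_generates (N : set A) (sN : submodule N)
    (r : A -> quot sN -> quot sN) :
  representation r -> (forall x u, r (g x) (qpi sN u) = qpi sN (g x * u)) ->
  N 1 -> forall a, N a.
Proof.
move=> rr rg N1 a.
have q1 : qpi sN 1 = 0 by apply/qpi_eqP; rewrite subr0.
have /= := intertwine (regular_rep A) rr (t := qpi sN)
  (fun x v => esym (rg x v)) a 1.
by rewrite q1 rep0 // /lmul mulr1 => /qpi_eqP; rewrite subr0.
Qed.

End Generators.

Section Enveloping.
Variables (K : comNzRingType) (L : lieType K) (U : algType K).
Variables (i : {linear L -> U}) (iU : enveloping i).

Lemma enveloping_dense : dense i.
Proof.
move=> B f f' ff' u.
have fc : lie_to_assoc (f \o i).
  by move=> x y; rewrite /= (proj1 iU) rmorphB !rmorphM.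
have [h [_ hu]] := (proj2 iU) _ _ fc.
by rewrite (hu f) // (hu f') // => x; rewrite /= ff'.
Qed.

Lemma enveloping_hom (V : lmodType K) (f : L -> V -> V) :
  (forall x, linear (f x)) -> (forall v, linear (f^~ v)) ->
  (forall x y v, f (lie x y) v = f x (f y v) - f y (f x v)) ->
  exists h : {lrmorphism U -> endo V},
    forall x, endo_aug (h (i x)) = 0 /\ endo_fun (h (i x)) =1 f x.
Proof.
move=> fl fr fb; pose e x : endo V := Endo 0 (fl x).
have el : linear e.
  move=> a x y; apply: endo_eq => [|v] /=; first by rewrite mulr0 addr0.
  exact: fr.
pose eL := GRing.isLinear.Build K L (endo V) _ e el.
pose eH : {linear L -> endo V} := HB.pack e eL.
have eB : lie_to_assoc eH.
  move=> x y; apply: endo_eq => [|v] /=; first by rewrite mulr0 subrr.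
  exact: fb.
by have [h [hi _]] := (proj2 iU) _ _ eB; exists h => x; rewrite hi.
Qed.

Lemma enveloping_rep (V : lmodType K) (f : L -> V -> V) :
  (forall x, linear (f x)) -> (forall v, linear (f^~ v)) ->
  (forall x y v, f (lie x y) v = f x (f y v) - f y (f x v)) ->
  exists r : U -> V -> V,
    representation r /\ forall x v, r (i x) v = f x v.
Proof.
move=> fl fr fb; have [h hi] := enveloping_hom fl fr fb.
exists (fun a => endo_fun (h a)); split=> [|x v]; first exact: hom_rep.
by rewrite (proj2 (hi x)).
Qed.

Lemma enveloping_aug :
  exists eps : {lrmorphism U -> K^o}, forall x, eps (i x) = 0.
Proof.
pose e (x : L) : K^o := 0.
have el : linear e by move=> a x y; rewrite /e scaler0 addr0.
pose eL := GRing.isLinear.Build K L K^o _ e el.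
pose eH : {linear L -> K^o} := HB.pack e eL.
have eB : lie_to_assoc eH by move=> x y; rewrite /= /e mulr0 subrr.
by have [h [hi _]] := (proj2 iU) _ _ eB; exists h => x; rewrite hi.
Qed.

Lemma enveloping_generated (N : set U) :
  submodule N -> N 1 -> (forall x u, N u -> N (i x * u)) -> forall u, N u.
Proof.
move=> sN N1 Ni; have [eps _] := enveloping_aug.
have qmul x v : qmap sN (lmul (i x)) (qpi sN v) = qpi sN (i x * v).
  by rewrite qmapE //; exact: Ni.
have [|||r [rr ri]] := @enveloping_rep (quot sN) (fun x => qmap sN (lmul (i x))).
- move=> x; apply: qmap_linear; exact: Ni.
- move=> v a x y; have [v' ->] := qpi_surj v.
  by rewrite !qmul -linearP /= linearP mulrDl scalerAl.
- move=> x y v; have [v' ->] := qpi_surj v.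
  by rewrite !qmul -linearB (proj1 iU) mulrBl -!mulrA.
apply: (dense_generates eps enveloping_dense rr _ N1) => x u.
by rewrite ri qmul.
Qed.

End Enveloping.

Section FreeEnveloping.
Variables (K : comNzRingType) (F : lieType K) (X : Type) (j : X -> F).
Hypothesis Fj : free_on j.
Variables (U : algType K) (i : {linear F -> U}).
Hypothesis iU : enveloping i.

Lemma free_enveloping_dense : dense (i \o j).
Proof.
move=> B f f' ff'; apply: enveloping_dense iU _ _ _ _ => x.
have fm (h : {lrmorphism U -> B}) :
    @lie_morphism K F (comm_lie B) (h \o i : {linear F -> comm_lie B}).
  by move=> y z; rewrite /= (proj1 iU) rmorphB !rmorphM.
have [h [_ _ hu]] := Fj (fun x => f (i (j x)) : comm_lie B).
rewrite -[f _]/((f \o i : {linear F -> comm_lie B}) x).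
rewrite -[f' _]/((f' \o i : {linear F -> comm_lie B}) x).
by rewrite hu // hu // => y /=; rewrite -ff'.
Qed.

(** The enveloping algebra of the free Lie algebra on X is the free associative
    algebra on X: any family of operators indexed by X extends. *)
Lemma free_enveloping_rep (V : lmodType K) (f : X -> V -> V) :
  (forall x, linear (f x)) ->
  exists r : U -> V -> V,
    representation r /\ forall x v, r (i (j x)) v = f x v.
Proof.
move=> fl; have [h [hm hj _]] := Fj (fun x => Endo 0 (fl x) : comm_lie (endo V)).
have hc : @lie_to_assoc _ _ (endo V) h by exact: hm.
have [e [ei _]] := (proj2 iU) (endo V) h hc.
exists (fun a => endo_fun (e a)); split=> [|x v]; first exact: hom_rep.
by rewrite ei hj.
Qed.

Lemma free_enveloping_generated (N : set U) :
  submodule N -> N 1 -> (forall x u, N u -> N (i (j x) * u)) -> forall u, N u.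
Proof.
move=> sN N1 Ni; have [eps _] := enveloping_aug iU.
have qmul x v : qmap sN (lmul (i (j x))) (qpi sN v) = qpi sN (i (j x) * v).
  by rewrite qmapE //; exact: Ni.
have [|r [rr ri]] :=
    @free_enveloping_rep (quot sN) (fun x => qmap sN (lmul (i (j x)))).
  move=> x; apply: qmap_linear; exact: Ni.
apply: (dense_generates eps free_enveloping_dense rr _ N1) => x u.
by rewrite ri qmul.
Qed.

End FreeEnveloping.

(** * Powers of the augmentation ideal and quotients of enveloping algebras *)

Section Ideals.
Variables (K : comNzRingType) (A : algType K).
Implicit Types (I S T N : set A).

Lemma mulspan_submod S T : submodule (mulspan S T).
Proof. exact: kspan_submod. Qed.

Lemma mulspanM S T x y : S x -> T y -> mulspan S T (x * y).
Proof. by move=> Sx Ty; apply: kspan_gen; exists x => //; exists y. Qed.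

Lemma mulspan_ind S T N : submodule N ->
  (forall x y, S x -> T y -> N (x * y)) -> forall u, mulspan S T u -> N u.
Proof. by move=> sN NM; apply: kspan_ind => // _ [x Sx [y Ty <-]]; exact: NM. Qed.

Lemma submod_mulr N a : submodule N -> submodule [set u | N (u * a)].
Proof.
move=> sN; split=> [|b u v /= Nu Nv]; rewrite /= ?mul0r; first exact: submod0.
by rewrite mulrDl -scalerAl; apply: submodD => //; exact: submodZ.
Qed.

Lemma submod_mull N a : submodule N -> submodule [set u | N (a * u)].
Proof. exact: (submod_preim (lmul a)). Qed.

Lemma mulspan_mull S T a u :
  (forall x, S x -> S (a * x)) -> mulspan S T u -> mulspan S T (a * u).
Proof.
move=> aS; move: u; apply: mulspan_ind => [|x y Sx Ty].
  exact: submod_mull (mulspan_submod _ _).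
by rewrite /= mulrA; apply: mulspanM => //; exact: aS.
Qed.

Lemma ideal2_submod I : ideal2 I -> submodule I.
Proof.
case=> I0 ID IM; split=> // a x y Ix Iy; apply: ID => //.
by rewrite -mulr_algl; exact: (IM _ _ Ix).1.
Qed.

Lemma idealXS I n : ideal2 I -> idealX I n.+1 = mulspan I (idealX I n).
Proof.
case: n => // iI; apply/seteqP; split=> u /= Iu.
  by rewrite -[u]mulr1; exact: mulspanM.
move: u Iu; apply: mulspan_ind; first exact: ideal2_submod.
by move=> x y Ix _; have [_ _ IM] := iI; exact: (IM _ _ Ix).2.
Qed.

Lemma idealX_submod I n : ideal2 I -> submodule (idealX I n).
Proof. by case: n => // n iI; rewrite idealXS //; exact: mulspan_submod. Qed.

Lemma idealX_mull I n u a : ideal2 I -> idealX I n u -> idealX I n (a * u).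
Proof.
move=> iI; case: n => // n; rewrite idealXS //.
by apply: mulspan_mull => x Ix; have [_ _ IM] := iI; exact: (IM _ _ Ix).1.
Qed.

Lemma idealXS_sub I n u : ideal2 I -> idealX I n.+1 u -> I u.
Proof.
move=> iI; rewrite idealXS //; move: u; apply: mulspan_ind => [|x y Ix _].
  exact: ideal2_submod.
by have [_ _ IM] := iI; exact: (IM _ _ Ix).2.
Qed.

Lemma idealXSr I n u a : ideal2 I -> idealX I n u -> I a -> idealX I n.+1 (u * a).
Proof.
move=> iI + Ia; elim: n u => [|n IHn] u.
  by move=> _; have [_ _ IM] := iI; exact: (IM _ _ Ia).1.
rewrite [idealX I n.+1]idealXS // => Iu; rewrite idealXS //.
by move: u Iu; apply: mulspan_ind => [|x y Ix Iy];
  [exact: submod_mulr (mulspan_submod _ _)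
  |rewrite /= -mulrA; apply: mulspanM => //; exact: IHn].
Qed.

End Ideals.

Section IdealMorphisms.
Variables (K : comNzRingType) (A B : algType K) (f : {lrmorphism A -> B}).
Variables (I : set A) (J : set B).
Hypotheses (iI : ideal2 I) (iJ : ideal2 J).

Lemma idealX_im n u :
  (forall v, I v -> J (f v)) -> idealX I n u -> idealX J n (f u).
Proof.
move=> IJ; elim: n u => // n IHn u; rewrite !idealXS //.
move: u; apply: mulspan_ind => [|x y Ix Iy]; last first.
  by rewrite rmorphM; apply: mulspanM; [exact: IJ|exact: IHn].
exact: submod_preim (mulspan_submod _ _).
Qed.

Lemma idealX_lift n v :
  (forall v, exists u, f u = v) -> (forall v, J v -> exists2 u, I u & f u = v) ->
  idealX J n v -> exists2 u, idealX I n u & f u = v.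
Proof.
move=> fs fIJ; elim: n v => [v _|n IHn v]; first by have [u fu] := fs v; exists u.
rewrite !idealXS //; move: v; apply: mulspan_ind => [|x y Jx Jy].
  exact: submod_im (mulspan_submod _ _).
have [u Iu <-] := fIJ _ Jx; have [w Iw <-] := IHn _ Jy.
by exists (u * w); [exact: mulspanM|rewrite rmorphM].
Qed.

End IdealMorphisms.

Section Augmentation.
Variables (K : comNzRingType) (L : lieType K) (U : algType K).
Variables (i : {linear L -> U}).

Lemma augmentation_ideal : ideal2 (augmentation i).
Proof.
split=> [N [] [N0 _ _] _ //|x y Ix Iy N NP|a x Ix].
  by have [[_ ND _] _] := NP; apply: ND; [exact: Ix|exact: Iy].
by split=> N NP; have [[_ _ NM] _] := NP; have [] := NM a x (Ix _ NP).
Qed.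

Lemma augmentation_gen x : augmentation i (i x).
Proof. by move=> N [_]; apply; exists x. Qed.

Lemma augmentation_ind (N : set U) : ideal2 N -> (forall x, N (i x)) ->
  forall u, augmentation i u -> N u.
Proof. by move=> iN Ni u; apply; split=> // _ [x _ <-]. Qed.

(** Since L generates the enveloping algebra, an action in which L raises a
    filtration by one preserves it under the whole algebra and raises it by one
    under the augmentation ideal.  Applied below to R/M and to the right regular
    module, both filtered by the lower central series of F/M. *)
Lemma filtered_action (V : zmodType) (act : V -> U -> V) (G : nat -> set V) :
  enveloping i ->
  (forall v a b, act v (a + b) = act v a + act v b) ->
  (forall v a b, act v (a * b) = act (act v a) b) ->
  (forall m, G m 0) -> (forall m v w, G m v -> G m w -> G m (v + w)) ->
  (forall m v, G m.+1 v -> G m v) ->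
  (forall m v (a : K), G m v -> G m (act v a%:A)) ->
  (forall m v x, G m v -> G m.+1 (act v (i x))) ->
  forall n u m v, idealX (augmentation i) n u -> G m v -> G (m + n)%N (act v u).
Proof.
move=> iU actD actM G0 GD GS GZ Gi.
have act0 v : act v 0 = 0 by apply: (addIr (act v 0)); rewrite -actD !add0r.
have subN k : submodule [set u | forall m v, G m v -> G (m + k)%N (act v u)].
  split=> [|a u w /= Nu Nw] m v Gv; first by rewrite act0.
  by rewrite actD -mulr_algl actM; apply: GD; [apply: Nu; exact: GZ|exact: Nw].
have act_all u m v : G m v -> G m (act v u).
  have := enveloping_generated iU (subN 0).
  move=> /(_ _ _ u m v); rewrite addn0; apply=> [m' v' Gv|x w Nw m' v' Gv].
    by rewrite -[1]scale1r addn0; exact: GZ.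
  by rewrite actM; apply: Nw; apply: GS; exact: Gi.
have act_aug u m v : augmentation i u -> G m v -> G m.+1 (act v u).
  move=> Iu; rewrite -addn1; move: u Iu m v; apply: augmentation_ind.
    split=> [m v _|x y Nx Ny m v Gv|a x Nx]; first by rewrite act0.
      by rewrite actD; apply: GD; [exact: Nx|exact: Ny].
    split=> m v Gv; rewrite actM; first by apply: Nx; exact: act_all.
    by apply: act_all; exact: Nx.
  by move=> x m v Gv; rewrite addn1; exact: Gi.
elim=> [|n IHn] u m v; first by rewrite addn0 => _; exact: act_all.
rewrite idealXS; last exact: augmentation_ideal.
move=> Iu; move: u Iu m v; apply: mulspan_ind; first exact: subN.
move=> x y Ix Iy m v Gv; rewrite actM addnS -addSn.
by apply: IHn => //; exact: act_aug.
Qed.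

End Augmentation.

Lemma lie_quotient_surj (K : comNzRingType) (F L : lieType K) (R : set F)
    (p : {linear F -> L}) : lie_quotient R p -> forall x, exists y, p y = x.
Proof.
case=> _ pT _ x; have [y _ <-] : range p x by rewrite pT.
by exists y.
Qed.

Section EnvelopingQuotient.
Variables (K : comNzRingType) (F L : lieType K) (R : set F).
Variables (p : {linear F -> L}).
Hypotheses (idR : lie_ideal R) (pR : lie_quotient R p).
Variables (UF UL : algType K) (iF : {linear F -> UF}) (iL : {linear L -> UL}).
Hypotheses (UFP : enveloping iF) (ULP : enveloping iL).

Lemma enveloping_map :
  exists pi : {lrmorphism UF -> UL}, forall x, pi (iF x) = iL (p x).
Proof.
have pc : lie_to_assoc (iL \o p).
  by move=> x y /=; have [-> _ _] := pR; rewrite (proj1 ULP).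
by have [h [hi _]] := (proj2 UFP) _ _ pc; exists h.
Qed.

Variable pi : {lrmorphism UF -> UL}.
Hypothesis piE : forall x, pi (iF x) = iL (p x).

Lemma enveloping_map_surj u : exists w, pi w = u.
Proof.
have := enveloping_generated ULP (N := pi @` setT).
case/(_ _ _ _ u) => [|||w _]; last by exists w.
- by apply: submod_im.
- by exists 1; rewrite ?rmorph1.
- move=> x _ [w _ <-]; have [y <-] := lie_quotient_surj pR x.
  by exists (iF y * w) => //; rewrite rmorphM /= piE.
Qed.

Lemma kernel_gen_mulr y u : mulspan setT (iF @` R) u ->
  mulspan setT (iF @` R) (u * iF y).
Proof.
move: u; apply: mulspan_ind => [|a _ _ [r Rr <-]].
  exact: submod_mulr (mulspan_submod _ _).
(* r y = y r - [y, r], and [y, r] is again in R. *)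
have -> : a * iF r * iF y = a * iF y * iF r - a * iF (lie y r).
  by rewrite (proj1 UFP) mulrBr !mulrA opprB addrC subrK.
apply: (submodB (mulspan_submod _ _)).
  by apply: mulspanM => //; exists r.
by apply: mulspanM => //; exists (lie y r) => //; exact: idR.2.
Qed.

Lemma kernel_mulr w u : mulspan setT (iF @` R) u ->
  mulspan setT (iF @` R) (u * w).
Proof.
move: u; apply: (enveloping_generated UFP (N := fun w => forall u,
  mulspan setT (iF @` R) u -> mulspan setT (iF @` R) (u * w))).
- split=> [u _|a x y Nx Ny u Ju]; first by rewrite mulr0; exact: (mulspan_submod _ _).1.
  rewrite mulrDr -scalerAr; apply: (mulspan_submod _ _).2; [exact: Nx|exact: Ny].
- by move=> u; rewrite mulr1.
- by move=> y v Nv u Ju; rewrite mulrA; apply: Nv; exact: kernel_gen_mulr.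
Qed.

(** The kernel of U(F) -> U(L) is U(F) R.  The span J of U(F) R is a two-sided
    ideal on which R acts as zero modulo J, so the quotient module U(F) / J is a
    representation of L, hence of U(L); an element of the kernel kills the class
    of 1, that is, lies in J. *)
Lemma enveloping_ker u : pi u = 0 <-> mulspan setT (iF @` R) u.
Proof.
split; last first.
  move: u; apply: mulspan_ind => [|a _ _ [r Rr <-]]; first exact: submod_ker.
  rewrite rmorphM /= piE; have [_ _ /(_ r)[_ ->//]] := pR.
  by rewrite linear0 mulr0.
pose J := mulspan setT (iF @` R).
have sJ : submodule J by exact: mulspan_submod.
have JR r u' : R r -> J (iF r * u').
  move=> Rr; apply: kernel_mulr; rewrite -[iF r]mul1r.
  by apply: mulspanM => //; exists r.
have /choice[s sK] := lie_quotient_surj pR.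
pose act x := qmap sJ (lmul (iF (s x))).
have actE x v : act x (qpi sJ v) = qpi sJ (iF (s x) * v).
  by rewrite /act qmapE // => w Jw; apply: mulspan_mull Jw.
have sE x y v : p x = p y -> qpi sJ (iF x * v) = qpi sJ (iF y * v).
  move=> xy; apply/qpi_eqP; rewrite -mulrBl -linearB; apply: JR.
  by have [_ _ /(_ (x - y))[+ _]] := pR; apply; rewrite linearB xy subrr.
have [|||r [rr rE]] := enveloping_rep ULP (V := quot sJ) (f := act).
- by move=> x; apply: qmap_linear => w Jw; apply: mulspan_mull Jw.
- move=> v a x y; have [v' ->] := qpi_surj v; rewrite !actE.
  rewrite (sE _ (a *: s x + s y)) ?linearP ?sK //.
  by rewrite mulrDl -scalerAl linearP.
- move=> x y v; have [v' ->] := qpi_surj v; rewrite !actE.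
  rewrite (sE _ (lie (s x) (s y))).
    by rewrite (proj1 UFP) mulrBl !mulrA linearB.
  by have [-> _ _] := pR; rewrite !sK.
have [eps _] := enveloping_aug UFP.
have tE x v : qpi sJ (lmul (iF x) v) = r (pi (iF x)) (qpi sJ v).
  by rewrite piE rE actE; apply: sE; rewrite sK.
have := intertwine eps (enveloping_dense UFP) (regular_rep UF) (comp_rep pi rr)
  (t := qpi sJ) tE u 1.
rewrite /lmul mulr1 /= => + piu; rewrite piu rep0l //.
by rewrite -[0]/(qpi sJ 0) => /qpi_eqP; rewrite subr0.
Qed.

End EnvelopingQuotient.

(** * Fox calculus in the free associative algebra *)

Section Fox.
Variables (K : comNzRingType) (F : lieType K) (X : Type) (j : X -> F).
Hypothesis Fj : free_on j.
Variables (U : algType K) (i : {linear F -> U}).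
Hypothesis iU : enveloping i.
Let aug := augmentation i.
Let iaug : ideal2 aug := augmentation_ideal i.

(** Left multiplication by a generator y acts on pairs of elements of U(F) by
    (u, v) |-> (v, y v) if y = x, and (u, v) |-> (0, y v) otherwise.  The first
    coordinate of w.(0, 1) is then the coefficient of w along x. *)
Lemma fox_derivative : exists D : X -> {linear U -> U},
  forall x, D x 1 = 0 /\
    forall y u, D x (i (j y) * u) = if `[< x = y >] then u else 0.
Proof.
suff /choice[D DP] x : exists D : {linear U -> U},
    D 1 = 0 /\ forall y u, D (i (j y) * u) = if `[< x = y >] then u else 0.
  by exists D.
pose f y (p : U * U) : U * U :=
  (if `[< x = y >] then p.2 else 0, i (j y) * p.2).
have fl y : linear (f y).
  move=> a [u v] [u' v']; rewrite /f /=; congr pair.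
    by case: ifP => //= _; rewrite scaler0 addr0.
  by rewrite mulrDr -scalerAr.
have [r [rr rE]] := free_enveloping_rep Fj iU fl.
have snd_lin : linear (fun p : U * U => p.2) by [].
pose t : {linear (U * U)%type -> U} := HB.pack (fun p : U * U => p.2)
  (GRing.isLinear.Build K (U * U)%type U _ (fun p : U * U => p.2) snd_lin).
have [eps _] := enveloping_aug iU.
have tE y p : t (r ((i \o j) y) p) = lmul ((i \o j) y) (t p) by rewrite /= rE.
have r2 u : (r u (0, 1)).2 = u.
  have := intertwine eps (free_enveloping_dense Fj iU) rr (regular_rep U) tE u.
  by move=> /(_ (0, 1)) /= ->; rewrite /lmul mulr1.
have Dl : linear (fun u => (r u (0, 1)).1).
  by case: rr => _ rl _ _ a u v; rewrite rl.
pose d : {linear U -> U} := HB.pack (fun u => (r u (0, 1)).1)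
  (GRing.isLinear.Build K U U _ (fun u => (r u (0, 1)).1) Dl).
exists d; rewrite /d /=; case: rr => _ _ r1 rM; split=> [|y u]; first by rewrite r1.
by rewrite rM rE /= r2.
Qed.

Lemma augmentation_free_span u :
  aug u -> mulspan (range (i \o j)) setT u.
Proof.
have [eps eps0] := enveloping_aug iU => Au.
have : mulspan (range (i \o j)) setT (u - (eps u : K)%:A).
  move: u {Au}; apply: (free_enveloping_generated Fj iU (N := fun u =>
    mulspan (range (i \o j)) setT (u - (eps u : K)%:A))).
  - split=> [|a u v /= Nu Nv]; rewrite ?linear0 ?scale0r ?subrr.
      exact: submod0 (mulspan_submod _ _).
    rewrite linearP /= scalerDl -scalerA opprD addrACA -scalerBr.
    exact: (mulspan_submod _ _).2.
  - by rewrite rmorph1 scale1r subrr; exact: submod0 (mulspan_submod _ _).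
  - move=> x u _; rewrite rmorphM /= eps0 mul0r scale0r subr0.
    by apply: mulspanM => //; exists x.
suff -> : eps u = 0 by rewrite scale0r subr0.
move: u Au; apply: augmentation_ind; last exact: eps0.
split=> [|u v /= u0 v0|a u /= u0]; rewrite ?rmorph0 //.
  by rewrite rmorphD /= u0 v0 addr0.
by rewrite !rmorphM /= u0 mulr0 mul0r.
Qed.

Variable D : X -> {linear U -> U}.
Hypothesis D1 : forall x, D x 1 = 0.
Hypothesis DE : forall x y u, D x (i (j y) * u) = if `[< x = y >] then u else 0.

Lemma fox_mulr x u w : aug u -> D x (u * w) = D x u * w.
Proof.
move/augmentation_free_span; move: u; apply: mulspan_ind => [|_ u [y _ <-] _].
  split=> [|a u v /= Nu Nv]; first by rewrite mul0r linear0 mul0r.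
  by rewrite mulrDl -scalerAl !linearP /= Nu Nv mulrDl -scalerAl.
by rewrite /= -mulrA !DE; case: ifP; rewrite ?mul0r.
Qed.

(** The augmentation ideal is the free right module on X; its elements are
    recovered from their Fox derivatives.  The proof asks for the formula over
    every large enough finite set of indices, so that it is stable under sums. *)
Lemma fox_expansion u : aug u -> exists s : seq {classic X},
  u = \sum_(x <- s) i (j x) * D x u.
Proof.
pose N := [set u | exists s : seq {classic X}, forall s', uniq s' ->
  {subset s <= s'} -> u = \sum_(x <- s') i (j x) * D x u].
move/augmentation_free_span => Au; suff [s sP] : N u.
  exists (undup s).
  by apply: sP => [|x]; rewrite ?undup_uniq ?mem_undup.
move: u Au; apply: mulspan_ind => [|_ u [y _ <-] _].
  split=> [|a u v [s us] [t vt]].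
    by exists [::] => s' _ _; rewrite big1 // => x _; rewrite linear0 mulr0.
  exists (s ++ t) => s' us' st.
  transitivity (a *: (\sum_(x <- s') i (j x) * D x u)
      + \sum_(x <- s') i (j x) * D x v).
    congr (a *: _ + _); [apply: us|apply: vt] => // x xs; apply: st.
      by rewrite mem_cat xs.
    by rewrite mem_cat xs orbT.
  rewrite scaler_sumr -big_split /=; apply: eq_bigr => x _.
  by rewrite linearP mulrDr -scalerAr.
exists [:: y] => s' us' /(_ y (mem_head _ _)) ys'.
rewrite (bigD1_seq (y : {classic X})) //= DE asboolT // big1 ?addr0 // => x xy.
by rewrite DE asboolF ?mulr0 // => xy'; rewrite xy' eqxx in xy.
Qed.

Lemma fox_ind (S : set U) u : submodule S -> aug u ->
  (forall x, S (i (j x) * D x u)) -> S u.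
Proof.
move=> sS /fox_expansion[s us] Su; rewrite us {us}.
elim: s => [|x s IHs]; first by rewrite big_nil; exact: submod0.
by rewrite big_cons; exact: submodD.
Qed.

Lemma fox_augmentation n u x :
  idealX aug n.+1 u -> idealX aug n (D x u).
Proof.
rewrite idealXS //; move: u; apply: mulspan_ind => [|a b Aa Ab].
  exact: submod_preim (idealX_submod _ _).
by rewrite /= fox_mulr //; exact: idealX_mull.
Qed.

(** The elements killed by every n-fold derivative, as are the noncommutative
    polynomials of degree less than n. *)
Fixpoint fox_nilp (n : nat) (u : U) : Prop :=
  if n is n'.+1 then forall x, fox_nilp n' (D x u) else u = 0.

Lemma fox_nilp_submod n : submodule (fox_nilp n).
Proof.
elim: n => [|n IHn].
  by split=> // a u v /= -> ->; rewrite scaler0 addr0.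
split=> [x|a u v /= Nu Nv x]; first by rewrite linear0; exact: submod0.
by rewrite linearP; apply: IHn.2.
Qed.

Lemma fox_nilp_le n m u : (n <= m)%N -> fox_nilp n u -> fox_nilp m u.
Proof.
elim: n m u => [m u _ ->|n IHn [//|m] u nm Nu x].
  exact: submod0 (fox_nilp_submod m).
exact: IHn.
Qed.

Lemma fox_nilpotent u : exists n, fox_nilp n u.
Proof.
apply: (free_enveloping_generated Fj iU (N := fun u => exists n, fox_nilp n u)).
- split; first by exists 0%N.
  move=> a v w [n Nv] [m Nw]; exists (maxn n m); apply: (fox_nilp_submod _).2.
    exact: fox_nilp_le (leq_maxl _ _) Nv.
  exact: fox_nilp_le (leq_maxr _ _) Nw.
- by exists 1%N => x; exact: D1.
- move=> y v [n Nv]; exists n.+1 => x; rewrite DE.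
  by case: ifP => // _; exact: submod0 (fox_nilp_submod n).
Qed.

(** Each derivative lowers by one both the order of vanishing and the degree, so
    an element of infinite order of vanishing is reduced to zero. *)
Lemma free_augmentation_residual u : (forall n, idealX aug n u) -> u = 0.
Proof.
move=> Au; have [n Nu] := fox_nilpotent u; move: (Au n) => {Au}.
elim: n u Nu => // n IHn u Nu Au.
have z0 : submodule [set 0 : U].
  by split=> // a v w /= -> ->; rewrite scaler0 addr0.
apply: (@fox_ind [set 0]) => //; first exact: idealXS_sub Au.
by move=> x /=; rewrite (IHn (D x u)) ?mulr0 //; exact: fox_augmentation.
Qed.

End Fox.

(** * The Magnus embedding and residual nilpotence *)

Section LowerCentral.
Variables (K : comNzRingType) (L : lieType K).

Lemma lower_central_submod n : submodule (lower_central L n).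
Proof. by case: n => [|[|n]]; [| |exact: kspan_submod]. Qed.

Lemma lower_central_lie n x y :
  lower_central L n.+1 y -> lower_central L n.+2 (lie x y).
Proof. by move=> Ly; apply: kspan_gen; exists x => //; exists y. Qed.

Lemma lower_centralS n : lower_central L n.+2 `<=` lower_central L n.+1.
Proof.
elim: n => // n IHn; apply: kspan_ind; first exact: lower_central_submod.
by move=> _ [x _ [y Ly <-]]; apply: lower_central_lie; exact: IHn.
Qed.

End LowerCentral.

Section AdjointModule.
Variables (K : comNzRingType) (F L Lt : lieType K) (R : set F).
Variables (p : {linear F -> L}) (q : {linear F -> Lt}).
Hypothesis pR : lie_quotient R p.
Variables (UL : algType K) (iL : {linear L -> UL}).
Hypothesis ULP : enveloping iL.

(** Each letter of L acts on R/M as a bracket in F/M, so a product of n letters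
    lands in the term of index n + 1 of the lower central series. *)
Lemma adjoint_lower_central (V : lmodType UL^c) (e : {additive V -> Lt}) :
  adjoint_module iL p q R e -> forall n u v,
  idealX (augmentation iL) n u -> lower_central Lt n.+1 (e ((u : UL^c) *: v)).
Proof.
move=> [einj _ eZ eL] n u v Iu.
pose act (w : V) (a : UL) : V := (a : UL^c) *: w.
pose G m := [set w : V | lower_central Lt m.+1 (e w)].
apply: (@filtered_action _ _ _ iL V act G ULP _ _ _ _ _ _ _ n u 0%N v Iu) => //.
- by move=> w a b; rewrite /act -scalerDl.
- by move=> w a b; rewrite /act scalerA.
- move=> m; rewrite /G /mkset raddf0.
  exact: (submod0 (lower_central_submod Lt m.+1)).
- move=> m w w'; rewrite /G /mkset raddfD.
  exact: submodD (lower_central_submod _ _).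
- by move=> m w; exact: lower_centralS.
- move=> m w a; rewrite /G /act /mkset eZ.
  exact: submodZ (lower_central_submod _ _).
- move=> m w x Gw; rewrite /G /act /mkset; have [y <-] := lie_quotient_surj pR x.
  rewrite eL lieC; apply: (submodN (lower_central_submod Lt _)).
  exact: lower_central_lie.
Qed.

End AdjointModule.

Section Presentation.
Variables (K : comNzRingType) (F : lieType K) (X : Type) (j : X -> F).
Hypothesis Fj : free_on j.
Variables (R : set F) (L : lieType K) (p : {linear F -> L}).
Hypotheses (idR : lie_ideal R) (pR : lie_quotient R p).
Variables (UF UL : algType K) (iF : {linear F -> UF}) (iL : {linear L -> UL}).
Hypotheses (UFP : enveloping iF) (ULP : enveloping iL).
Variables (Lt : lieType K) (q : {linear F -> Lt}).
Hypothesis qM : lie_quotient (Mset iF R) q.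

Let aF := augmentation iF.
Let aL := augmentation iL.
Let iaF : ideal2 aF := augmentation_ideal iF.
Let iaL : ideal2 aL := augmentation_ideal iL.
Let J := mulspan setT (iF @` R).
Let Q := mulspan aF (iF @` R).
Let sJ : submodule J := mulspan_submod _ _.
Let sQ : submodule Q := mulspan_submod _ _.

Variable pi : {lrmorphism UF -> UL}.
Hypothesis piE : forall x, pi (iF x) = iL (p x).

Let piJ u : pi u = 0 <-> J u := enveloping_ker idR pR UFP ULP piE u.

Variable D : X -> {linear UF -> UF}.
Hypothesis D1 : forall x, D x 1 = 0.
Hypothesis DE :
  forall x y u, D x (iF (j y) * u) = if `[< x = y >] then u else 0.

Lemma aug_mul_ker a z : aF a -> J z -> Q (a * z).
Proof.
move=> Aa; move: z; apply: mulspan_ind => [|b r _ Rr]; first exact: submod_mull.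
by rewrite /= mulrA; apply: mulspanM => //; have [_ _ /(_ b a Aa)[]] := iaF.
Qed.

Lemma aug_rel_mulr u w : Q u -> Q (u * w).
Proof.
move: u; apply: mulspan_ind => [|a _ Aa [r Rr <-]]; first exact: submod_mulr.
rewrite /= -mulrA; apply: aug_mul_ker => //; apply: (kernel_mulr idR UFP).
by rewrite -[iF r]mul1r; apply: mulspanM => //; exists r.
Qed.

(** The Magnus embedding: modulo M, an element of F is determined by the images
    in U(L) of its Fox derivatives. *)
Lemma aug_rel_foxP u : aF u -> Q u <-> forall x, J (D x u).
Proof.
move=> Au; split=> [+ x|Ju].
  move: u {Au}; apply: mulspan_ind => [|a r Aa Rr].
    exact: submod_preim.
  by rewrite /= (fox_mulr Fj UFP DE) //; exact: mulspanM.
apply: (fox_ind Fj UFP DE sQ Au) => x; apply: aug_mul_ker => //.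
exact: augmentation_gen.
Qed.

Lemma pi_aug n u : idealX aF n u -> idealX aL n (pi u).
Proof.
apply: idealX_im => //; apply: augmentation_ind => [|x]; last first.
  by rewrite piE; exact: augmentation_gen.
have [I0 ID IM] := iaL.
split=> [|u' w /= Iu Iw|a w /= Iw]; rewrite ?rmorph0 // ?rmorphD.
  exact: ID.
by rewrite !rmorphM; exact: IM.
Qed.

Lemma pi_aug_lift n v : idealX aL n v -> exists2 u, idealX aF n u & pi u = v.
Proof.
apply: idealX_lift => // [|]; first exact: (enveloping_map_surj pR ULP piE).
have [I0 ID IM] := iaF.
apply: augmentation_ind => [|x]; last first.
  have [y <-] := lie_quotient_surj pR x; exists (iF y) => //.
  exact: augmentation_gen.
split=> [|_ _ [u Iu <-] [w Iw <-]|a _ [w Iw <-]].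
- by exists 0; rewrite ?rmorph0.
- by exists (u + w); rewrite ?rmorphD //; exact: ID.
have [b <-] := enveloping_map_surj pR ULP piE a.
split; [exists (b * w)|exists (w * b)]; rewrite ?rmorphM //.
  exact: (IM _ _ Iw).1.
exact: (IM _ _ Iw).2.
Qed.

Lemma lower_central_lift n y : lower_central Lt n.+1 y ->
  exists2 f, idealX aF n.+1 (iF f) & q f = y.
Proof.
elim: n y => [y _|n IHn].
  have [f <-] := lie_quotient_surj qM y.
  by exists f => //; exact: augmentation_gen.
apply: kspan_ind.
  split=> [|a _ _ [f If <-] [g Ig <-]].
    by exists 0; rewrite ?linear0 //; exact: submod0 (idealX_submod _ _).
  exists (a *: f + g); rewrite ?linearP //.
  by apply: (idealX_submod _ _).2.
move=> _ [x _ [y Ly <-]]; have [f If <-] := IHn y Ly.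
have [g <-] := lie_quotient_surj qM x; exists (lie g f); last first.
  by have [-> _ _] := qM.
rewrite (proj1 UFP); apply: (submodB (idealX_submod _ iaF)).
  by rewrite idealXS //; apply: mulspanM => //; exact: augmentation_gen.
by apply: idealXSr => //; exact: augmentation_gen.
Qed.

(** Derivatives of elements of the n-th term of the lower central series lie in
    the (n - 1)-st power of the augmentation ideal; the Magnus embedding turns
    residual nilpotence of U(L) into that of F/M. *)
Lemma residual_lower_central :
  (forall u, (forall n, idealX aL n.+1 u) -> u = 0) ->
  forall y, (forall n, lower_central Lt n.+1 y) -> y = 0.
Proof.
move=> resL y Ly; have [f fy] := lie_quotient_surj qM y; rewrite -fy.
have [_ _ qK] := qM; apply/qK; rewrite /Mset /preimage /=.
have Af : aF (iF f) by exact: augmentation_gen.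
apply/(aug_rel_foxP Af) => x; apply/piJ; apply: resL => n.
have [g Ig gy] := lower_central_lift (Ly n.+1).
have : Q (iF (f - g)) by apply/qK; rewrite linearB fy gy subrr.
have Afg : aF (iF (f - g)) by exact: augmentation_gen.
move=> /(aug_rel_foxP Afg)/(_ x)/piJ; rewrite !linearB => /eqP.
rewrite subr_eq0 => /eqP ->; apply: pi_aug.
exact: (fox_augmentation Fj UFP DE).
Qed.

(** The action of U(F) on R/M seen inside the right regular module: modulo
    varpi(F) R one has r y = [r, y], so r w is congruent to an element of R, as
    deep in the lower central series as w is in the augmentation filtration. *)
Lemma relation_lower_central r w n : R r -> idealX aF n w ->
  exists r', [/\ R r', lower_central Lt n.+1 (q r') & Q (iF r * w - iF r')].
Proof.
move=> Rr Iw.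
pose G m := [set u | exists r', [/\ R r', lower_central Lt m.+1 (q r')
  & Q (u - iF r')]].
have sG m : submodule (G m).
  split=> [|a u v [f [Rf Lf Qf]] [g [Rg Lg Qg]]].
    exists 0; split; first exact: idR.1.1.
      by rewrite linear0; exact: submod0 (lower_central_submod Lt m.+1).
    by rewrite linear0 subrr; exact: submod0.
  exists (a *: f + g); split; first exact: idR.1.2.
    by rewrite linearP; apply: (lower_central_submod _ _).2.
  by rewrite linearP opprD addrACA -scalerBr; exact: sQ.2.
apply: (@filtered_action _ _ _ iF UF (fun v a => v * a) G UFP
  _ _ _ _ _ _ _ n w 0%N (iF r) Iw).
- by move=> *; rewrite mulrDr.
- by move=> *; rewrite mulrA.
- by move=> m; exact: submod0.
- by move=> m v v'; exact: submodD.
- by move=> m v [f [Rf Lf Qf]]; exists f; split => //; exact: lower_centralS.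
- by move=> m v a Gv; rewrite mulr_algr; exact: submodZ.
- move=> m v x [f [Rf Lf Qf]]; exists (- lie x f); split.
  + by apply: (submodN idR.1); exact: idR.2.
  + rewrite linearN; apply: (submodN (lower_central_submod Lt _)).
    by have [-> _ _] := qM; exact: lower_central_lie.
  + have -> : v * iF x - iF (- lie x f) = (v - iF f) * iF x + iF x * iF f.
      by rewrite linearN opprK (proj1 UFP) mulrBl addrA addrAC.
    apply: (submodD sQ); first exact: aug_rel_mulr.
    by apply: mulspanM; [exact: augmentation_gen|exists f].
- by exists r; split => //; rewrite subrr; exact: submod0.
Qed.

(** Let u lie in all powers of the augmentation ideal of U(L), and lift it to w.
    If some r in R is not in M, then r w is zero in R/M, and the Magnus embedding
    places R/M in a free right U(L)-module, which is torsion-free when U(L) is a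
    domain; as r has a nonzero coordinate, u = 0.  If R = M, then R is contained
    in varpi(F) R, hence in every power of varpi(F), so it maps to zero in U(F)
    and U(L) = U(F) is residually nilpotent. *)
Lemma residual_augmentation : GRing.integral_domain_axiom UL ->
  (forall y, (forall n, lower_central Lt n.+1 y) -> y = 0) ->
  forall u, (forall n, idealX aL n.+1 u) -> u = 0.
Proof.
move=> domU resL u Iu; have [w wu] := enveloping_map_surj pR ULP piE u.
have [_ _ qK] := qM.
have [RM|/existsNP[r /not_implyP[Rr rM]]] := EM (forall r, R r -> Q (iF r)).
  have R0 r : R r -> iF r = 0.
    move=> Rr; apply: (free_augmentation_residual Fj UFP D1 DE) => n.
    elim: n r Rr => // n IHn r /RM; rewrite idealXS //.
    move: (iF r); apply: mulspan_ind => [|a _ Aa [s Rs <-]].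
      exact: mulspan_submod.
    by apply: mulspanM => //; exact: IHn.
  have J0 z : J z -> z = 0.
    move: z; apply: mulspan_ind => [|a _ _ [s Rs <-]].
      by split=> // a v z /= -> ->; rewrite scaler0 addr0.
    by rewrite /= R0 ?mulr0.
  rewrite -wu (_ : w = 0) ?rmorph0 //.
  apply: (free_augmentation_residual Fj UFP D1 DE) => -[//|n].
  have [v Iv vu] := pi_aug_lift (Iu n).
  suff -> : w = v by [].
  apply/eqP; rewrite -subr_eq0; apply/eqP/J0/piJ.
  by rewrite rmorphB /= wu vu subrr.
have Ar : aF (iF r) by exact: augmentation_gen.
have Qw : Q (iF r * w).
  have step n : exists r', [/\ R r', lower_central Lt n.+1 (q r')
      & Q (iF r * w - iF r')].
    have [v Iv vu] : exists2 v, idealX aF n v & pi v = u.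
      by case: n => [|n]; [exists w|exact: pi_aug_lift].
    have [r' [Rr' Lr' Qr']] := relation_lower_central Rr Iv.
    exists r'; split => //; apply: (submod_trans sQ) Qr' => //.
    rewrite -mulrBr; apply: aug_mul_ker => //; apply/piJ.
    by rewrite rmorphB /= wu vu subrr.
  have [r0 [Rr0 _ Qr0]] := step 0%N.
  rewrite -[_ * w](subrK (iF r0)); apply: (submodD sQ) => //; apply/qK.
  apply: resL => n; have [r1 [Rr1 Lr1 Qr1]] := step n.
  suff -> : q r0 = q r1 by [].
  apply/eqP; rewrite -subr_eq0 -linearB; apply/eqP/qK.
  rewrite /Mset /preimage /= linearB.
  by apply: (submod_trans sQ) Qr1 => //; exact: (submodBC sQ).
have Arw : aF (iF r * w) by have [_ _ /(_ w _ Ar)[]] := iaF.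
apply: contrapT => u0; apply: rM; apply/(aug_rel_foxP Ar) => x; apply/piJ.
move: Qw => /(aug_rel_foxP Arw)/(_ x).
rewrite (fox_mulr Fj UFP DE) // => /piJ; rewrite rmorphM /= wu.
by move/domU => /orP[/eqP //|/eqP].
Qed.

End Presentation.

(** * Bases of vector spaces *)

Section LinearExtension.
Variables (K : comNzRingType) (T : choiceType) (V : lmodType K).
Implicit Types (h : T -> V) (g : {malg K[T]}).

Definition lext h g : V := \sum_(k <- msupp g) g@_k *: h k.

Lemma lextEw h g (d : {fset T}) :
  (msupp g `<=` d)%fset -> lext h g = \sum_(k <- d) g@_k *: h k.
Proof.
move=> le; rewrite /lext (big_fset_incl _ le) => //= x _ /mcoeff_outdom ->.
by rewrite scale0r.
Qed.

Fact lext_linear h : linear (lext h).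
Proof.
move=> a u v; pose d := (msupp u `|` msupp v `|` msupp (a *: u + v))%fset.
have du : (msupp u `<=` d)%fset by rewrite /d -fsetUA fsubsetUl.
have dv : (msupp v `<=` d)%fset by rewrite /d fsetUAC fsubsetUr.
have dw : (msupp (a *: u + v) `<=` d)%fset by rewrite /d fsubsetUr.
rewrite (lextEw _ du) (lextEw _ dv) (lextEw _ dw).
rewrite scaler_sumr -big_split; apply: eq_bigr => k _ /=.
by rewrite mcoeffD mcoeffZ scalerDl scalerA.
Qed.

HB.instance Definition _ h :=
  GRing.isLinear.Build K {malg K[T]} V _ (lext h) (lext_linear h).

Lemma lextU h k : lext h << k >> = h k.
Proof. by rewrite (lextEw _ msuppU_le) big_seq_fset1 mcoeffUU scale1r. Qed.

Lemma lext_linearl a h h' g :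
  lext (fun k => a *: h k + h' k) g = a *: lext h g + lext h' g.
Proof.
rewrite /lext scaler_sumr -big_split; apply: eq_bigr => k _ /=.
by rewrite scalerDr !scalerA mulrC.
Qed.

Lemma malgUZ (c : K) k : << c *g k >> = c *: << k >> :> {malg K[T]}.
Proof. by apply/malgP => k'; rewrite mcoeffZ !mcoeffU mulrnAr mulr1. Qed.

Lemma malg_ind (N : set {malg K[T]}) g : submodule N ->
  (forall k, k \in msupp g -> N << k >>) -> N g.
Proof.
move=> sN Ng; rewrite [g]monalgE big_seq.
elim/big_ind: _ => [|u v|k kg]; [exact: submod0|exact: submodD|].
by rewrite malgUZ; apply: submodZ => //; exact: Ng.
Qed.

End LinearExtension.

Section TotalOrder.
Variables (T : eqType) (r : rel T).

Lemma well_order_total : well_order r -> total_order r.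
Proof.
move=> wr; have ch : wo_chain r predT by move=> A _; exact: wr.
have tot : total r by move=> x y; exact: (wo_chainW ch).
have refl : reflexive r by move=> x; rewrite -[r x x]orbb tot.
split=> //; split; last by move=> x y; apply: (wo_chain_antisymmetric ch).
split=> // y x z rxy ryz.
have [|m [[mA mle] _]] := wr [pred t | t \in [:: x; y; z]].
  by exists x; rewrite !inE eqxx.
have anti : antisymmetric r by move=> a b; apply: (wo_chain_antisymmetric ch).
have [mx my mz] : [/\ r m x, r m y & r m z].
  by split; apply: mle; rewrite !inE eqxx ?orbT.
move: mA; rewrite !inE => /or3P[] /eqP mE; rewrite mE in mx my mz.
- exact: mz.
- by have -> : x = y by apply: anti; rewrite rxy.
- by have <- : y = z by apply: anti; rewrite ryz.
Qed.

Lemma seq_greatest (lt : T -> T -> Prop) (s : seq T) :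
  (forall x y z, lt x y -> lt y z -> lt x z) ->
  (forall x y, x <> y -> lt x y \/ lt y x) -> s != [::] ->
  exists2 x, x \in s & forall y, y \in s -> y = x \/ lt y x.
Proof.
move=> ltr lto; elim: s => // x [_ _|y s IHs _].
  by exists x; rewrite ?mem_head // => z; rewrite inE => /eqP; left.
have [//|m ms mP] := IHs.
have [->|/eqP/lto[xm|mx]] := eqVneq x m.
- exists m; rewrite ?mem_head // => z; rewrite inE => /orP[/eqP ->|/mP//].
  by left.
- exists m; first by rewrite inE ms orbT.
  by move=> z; rewrite inE => /orP[/eqP ->|/mP//]; right.
- exists x; rewrite ?mem_head // => z; rewrite inE => /orP[/eqP ->|/mP].
    by left.
  by case=> [->|zm]; right => //; exact: ltr zm mx.
Qed.

End TotalOrder.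

Section Basis.
Variables (K : comNzRingType) (V : lmodType K).
Hypothesis fieldK : forall a : K, a != 0 -> exists b : K, b * a = 1.

(** For a well-order on V, the vectors that are not spanned by smaller ones form
    a basis: a least vector outside the span would be spanned by smaller
    vectors, and the greatest vector of a relation would be spanned by the
    others. *)
Lemma basis_exists : exists (I : choiceType) (b : I -> V)
  (c : {linear V -> {malg K[I]}}),
  (forall v, lext b (c v) = v) /\ forall i, c (b i) = << i >>.
Proof.
have [r wr] := well_ordering_principle V.
have [[[refl trans] anti] tot] := well_order_total wr.
pose lower v := [set w | r w v && (w != v)].
pose B := [pred v | `[< ~ kspan (lower v) v >]].
pose I := {v : V | B v}; pose b (i : I) : V := \val i.
have binj g : lext b g = 0 -> g = 0.
  move=> g0; apply: contrapT => gn0.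
  have [|||k kg kmax] := @seq_greatest I (fun i k => r (b i) (b k) && (i != k))
      (msupp g).
  - move=> x y z /andP[xy nxy] /andP[yz nyz]; rewrite (trans _ _ _ xy yz) /=.
    apply/eqP => xz; move/eqP: nxy; apply; apply: val_inj; apply: anti.
    by rewrite xy xz.
  - move=> x y /eqP xy; case/orP: (tot (b x) (b y)) => ?; [left|right].
      by apply/andP.
    by apply/andP; rewrite eq_sym.
  - apply/eqP => g0'; apply: gn0; apply/malgP => i; rewrite mcoeff0.
    by apply: mcoeff_outdom; rewrite -[_ \in _]/(i \in enum_fset _) g0'.
  have [|a ak] := fieldK (a := g@_k); first by rewrite mcoeff_neq0.
  have /asboolP := valP k; apply.
  have sk := kspan_submod (lower (b k)).
  have kE : \val k = - (a *: \sum_(i <- (msupp g `\ k)%fset) g@_i *: b i).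
    move: g0; rewrite /lext (big_fsetD1 k) //= => /eqP.
    rewrite addr_eq0 => /eqP g0; rewrite -scalerN -g0.
    by rewrite scalerA ak scale1r.
  rewrite [X in kspan _ X]kE.
  apply: (submodN sk); apply: (submodZ _ sk); rewrite big_seq.
  apply: (big_ind (kspan (lower (b k)))) => [|u v|i].
  - exact: (submod0 sk).
  - exact: (submodD sk).
  rewrite in_fsetD1 => /andP[ik ig].
  apply: (submodZ _ sk); apply: kspan_gen; rewrite /lower /=.
  have [ie|/andP[ri _]] := kmax _ ig; first by rewrite ie eqxx in ik.
  by rewrite ri; apply: contra ik => /eqP/val_inj ->.
have bsurj v : exists g, lext b g = v.
  apply: contrapT => nv.
  pose A := [pred v | `[< ~ exists g, lext b g = v >]].
  have [|m [[/asboolP mA mle] _]] := wr A; first by exists v; apply/asboolP.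
  apply: mA; have [Bm|/asboolPn/contrapT km] := boolP (B m).
    by exists << Sub m Bm >>; rewrite lextU.
  suff : range (lext b) m by case=> g _ <-; exists g.
  apply: (kspan_ind _ _ km) => [|w /andP[wm nwm]].
    exact: submod_im.
  apply: contrapT => nw; have /mle mw : w \in A.
    by apply/asboolP => -[g gw]; apply: nw; exists g.
  by move/eqP: nwm; apply; apply: anti; rewrite wm mw.
have [c cP] := choice bsurj.
have lextI : injective (lext b).
  move=> g g' /eqP; rewrite -subr_eq0 -linearB => /eqP/binj/eqP.
  by rewrite subr_eq0 => /eqP.
have cl : linear c.
  by move=> a u v; apply: lextI; rewrite linearP /= !cP.
pose cL : {linear V -> {malg K[I]}} :=
  HB.pack c (GRing.isLinear.Build K V {malg K[I]} _ c cl).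
exists I, b, cL.
by split=> //= i; apply: lextI; rewrite cP lextU.
Qed.

End Basis.

(** * The action of a Lie algebra on the polynomial ring of a basis *)

Local Notation "m ** n" := (mmul m n) (at level 40, left associativity).

Section OrderedMonomials.
Variables (I : choiceType) (le : rel I).
Hypothesis leT : total_order le.
Implicit Types (i j : I) (m n N : {cmonom I}).

Let le_refl : reflexive le. Proof. by case: leT => -[[]]. Qed.
Let le_trans : transitive le. Proof. by case: leT => -[[]]. Qed.
Let le_anti : antisymmetric le. Proof. by case: leT => -[[]]. Qed.
Let le_total : total le. Proof. by case: leT. Qed.

Definition below i m := forall k, m k != 0%N -> le i k.

Definition least m : option I := ohead (sort le (finsupp m)).

Lemma below1 i : below i mone.
Proof. by move=> k; rewrite cm1. Qed.

Lemma belowM i m n : below i m -> below i n -> below i (m ** n).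
Proof.
by move=> im jn k; rewrite cmM addn_eq0 negb_and => /orP[/im|/jn].
Qed.

Lemma belowU i j : le i j -> below i (ucm j).
Proof. by move=> ij k; rewrite cmU; case: (j =P k) => [<-|]. Qed.

Lemma below_trans i j m : le i j -> below j m -> below i m.
Proof. by move=> ij jm k /jm; exact: le_trans. Qed.

Lemma least1 : least mone = None.
Proof. by rewrite /least mdom1. Qed.

Lemma leastP m : if least m is Some j then m j != 0%N /\ below j m else m = mone.
Proof.
rewrite /least; case E : (sort _ _) => [|j s] /=.
  apply/eqP/cmP => i; rewrite cm1; apply/eqP; rewrite cmE_eq0.
  by rewrite -[_ \in _](mem_sort le) E.
have jm k : (k \in j :: s) = (m k != 0%N).
  by rewrite -E mem_sort cmE_neq0.
split; first by rewrite -jm mem_head.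
move=> k; rewrite -jm inE => /orP[/eqP ->//|].
have := sort_sorted le_total (finsupp m); rewrite E /=.
by move=> /(order_path_min le_trans)/allP; apply.
Qed.

Lemma leastM j N : below j N -> least (ucm j ** N) = Some j.
Proof.
move=> jN; have := leastP (ucm j ** N); case: (least _) => [k [kn kb]|].
  congr Some; apply: le_anti; rewrite kb ?cmM ?cmUU //=.
  move: kn; rewrite cmM cmU; case: (j =P k) => [-> //|_ /=].
  by rewrite add0n => /jN.
by move=> /eqP; rewrite cmM_eq1 cm1_eq1.
Qed.

Lemma divcmK j m : m j != 0%N -> m = ucm j ** divcm m (ucm j).
Proof.
move=> mj; apply/eqP/cmP => k; rewrite cmM divcmE cmU.
by case: eqP => [<-|_]; rewrite ?add0n ?subn0 // subnKC // lt0n.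
Qed.

Lemma mulcmK j N : divcm (ucm j ** N) (ucm j) = N.
Proof. by apply/eqP/cmP => k; rewrite divcmE cmM cmU addKn. Qed.

Lemma cmonom_cases m :
  m = mone \/ exists j N, below j N /\ m = ucm j ** N.
Proof.
have := leastP m; case: (least m) => [j [mj jm]|->]; [right|by left].
exists j, (divcm m (ucm j)); split; last exact: divcmK.
by move=> k kn; apply: jm; apply: contra kn; rewrite divcmE => /eqP ->.
Qed.

Lemma mdegUM j N : mdeg (ucm j ** N) = (mdeg N).+1.
Proof. by rewrite mdegM mdegU. Qed.

Lemma cmonom_ind (P : {cmonom I} -> Prop) :
  P mone -> (forall j N, below j N -> P N -> P (ucm j ** N)) -> forall m, P m.
Proof.
move=> P1 PM m; move: {2}(mdeg m) (leqnn (mdeg m)) => n.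
elim: n m => [|n IHn] m mn.
  by rewrite (mdeg_eq0I (m := m)) //; apply/eqP; rewrite -leqn0.
have [-> //|[j [N [jN mE]]]] := cmonom_cases m; rewrite mE; apply: PM => //.
by apply: IHn; move: mn; rewrite mE mdegUM.
Qed.

End OrderedMonomials.

HB.lock Definition mon (K : comNzRingType) (I : choiceType) (m : {cmonom I}) :
  {malg K[{cmonom I}]} := << m >>.

Section DegreeFiltration.
Variables (K : comNzRingType) (I : choiceType).
Notation S := {malg K[{cmonom I}]}.
Notation mon := (@mon K I).
Implicit Types (s t : S) (m : {cmonom I}).

Lemma monE m : mon m = << m >>.
Proof. by rewrite mon.unlock. Qed.

Lemma lext_mon (V : lmodType K) (h : {cmonom I} -> V) m : lext h (mon m) = h m.
Proof. by rewrite monE lextU. Qed.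

Lemma mcoeff_mon m n : (mon m)@_n = (m == n)%:R.
Proof. by rewrite monE mcoeffU. Qed.

Lemma monM m n : mon (m ** n) = mon m * mon n.
Proof. by rewrite !monE malgM_def fgmulUU mulr1. Qed.

Definition deg_lt n : set S := [set s | forall m, (n <= mdeg m)%N -> s@_m = 0].

Lemma deg_lt_submod n : submodule (deg_lt n).
Proof.
split=> [m _|a s t Ds Dt m nm]; first by rewrite mcoeff0.
by rewrite mcoeffD mcoeffZ Ds // Dt // mulr0 addr0.
Qed.

Lemma deg_ltW n k s : (n <= k)%N -> deg_lt n s -> deg_lt k s.
Proof. by move=> nk Ds m km; apply: Ds; exact: leq_trans km. Qed.

Lemma deg_ltU n m : (mdeg m < n)%N -> deg_lt n (mon m).
Proof.
move=> mn k nk; rewrite mcoeff_mon; case: eqP => // mk.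
by move: mn; rewrite mk ltnNge nk.
Qed.

Lemma deg_lt_msupp n s m : deg_lt n s -> m \in msupp s -> (mdeg m < n)%N.
Proof.
by move=> Ds; rewrite -mcoeff_neq0 ltnNge; apply: contra => /Ds ->.
Qed.

Lemma deg_lt_ind n (N : set S) s : submodule N -> deg_lt n s ->
  (forall m, (mdeg m < n)%N -> N (mon m)) -> N s.
Proof.
move=> sN Ds Nm; apply: malg_ind => // m /(deg_lt_msupp Ds) md.
by rewrite -monE; exact: Nm.
Qed.

Lemma deg_lt_msize s : deg_lt (msize s) s.
Proof. by move=> m /msize_mdeg_ge/mcoeff_outdom. Qed.

End DegreeFiltration.
Arguments deg_lt_submod {K I} n.

Section LetterAction.
Variables (K : comNzRingType) (L : lieType K).
Variables (I : choiceType) (b : I -> L) (c : {linear L -> {malg K[I]}}).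
Hypotheses (cE : forall i, c (b i) = << i >>).
Notation S := {malg K[{cmonom I}]}.
Notation mon := (@mon K I).
Implicit Types (s t : S) (w : I -> {cmonom I} -> S).

Let letter w s i : S := mon (ucm i) * s + lext (w i) s.

Fact letter_linear w a s t :
  letter w (a *: s + t) = fun i => a *: letter w s i + letter w t i.
Proof.
apply/funext => i; rewrite /letter mulrDr -scalerAr linearP scalerDr /=.
by rewrite addrACA.
Qed.

Let extend w x s : S := lext (letter w s) (c x).

Fact extend_linear w x : linear (extend w x).
Proof. by move=> a s t; rewrite /extend letter_linear lext_linearl. Qed.

(** Any table [w] of corrections to the multiplication by variables defines
    operators indexed by [L], linearly; only the right table makes them satisfy
    the bracket relation. *)
Lemma act_with_exists :
  exists A : (I -> {cmonom I} -> S) -> L -> {linear S -> S},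
    (forall w a x y s, A w (a *: x + y) s = a *: A w x s + A w y s) /\
    (forall w i m, A w (b i) (mon m) = mon (mmul (ucm i) m) + w i m).
Proof.
pose A w x : {linear S -> S} := HB.pack (extend w x)
  (GRing.isLinear.Build K S S _ (extend w x) (extend_linear w x)).
exists A; split=> [w a x y s|w i m] /=; first by rewrite /extend !linearP.
by rewrite /extend cE lextU /letter lext_mon monM.
Qed.

End LetterAction.

Section PBW.
Variables (K : comNzRingType) (L : lieType K).
Variables (I : choiceType) (b : I -> L) (c : {linear L -> {malg K[I]}}).
Hypothesis cK : forall x, lext b (c x) = x.
Variable le : rel I.
Hypothesis leT : total_order le.
Notation S := {malg K[{cmonom I}]}.
Notation mon := (@mon K I).
Variable A : (I -> {cmonom I} -> S) -> L -> {linear S -> S}.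
Hypothesis AlP : forall w a x y s, A w (a *: x + y) s = a *: A w x s + A w y s.
Hypothesis AU : forall w i m, A w (b i) (mon m) = mon (ucm i ** m) + w i m.
Implicit Types (s t : S) (x y : L) (i j : I) (m n N : {cmonom I}).

Lemma act_with_submodl w s (N : set S) :
  submodule N -> submodule [set x | N (A w x s)].
Proof.
move=> sN; have A0 : A w 0 s = 0.
  by have := AlP w (-1) 0 0 s; rewrite scaler0 addr0 scaleN1r addNr.
split=> [|a x y /= Nx Ny]; first by rewrite /= A0; exact: submod0.
by rewrite AlP; apply: sN.2.
Qed.

Lemma act_with_submod w x (N : set S) :
  submodule N -> submodule [set s | N (A w x s)].
Proof. exact: (submod_preim (A w x)). Qed.

Lemma basis_ind (N : set L) : submodule N -> (forall i, N (b i)) -> forall x, N x.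
Proof.
move=> sN Nb x; rewrite -[x]cK.
apply: (malg_ind (N := [set g | N (lext b g)])) => [|i _].
  exact: (submod_preim (lext b)).
by rewrite /= lextU.
Qed.

Lemma act_with_deg w k x s :
  (forall i m, (mdeg m < k)%N -> deg_lt (mdeg m).+1 (w i m)) ->
  deg_lt k s -> deg_lt k.+1 (A w x s).
Proof.
move=> wk Ds.
apply: (deg_lt_ind (act_with_submod w x (deg_lt_submod k.+1)) Ds) => m mk.
move: x; apply: basis_ind => [|i].
  exact: act_with_submodl (deg_lt_submod k.+1).
rewrite /= AU; apply: (submodD (deg_lt_submod k.+1)).
  by apply: deg_ltU; rewrite mdegUM.
by apply: deg_ltW (wk i m mk); rewrite ltnW.
Qed.

Lemma act_with_eq w w' k x s :
  (forall i m, (mdeg m < k)%N -> w i m = w' i m) ->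
  deg_lt k s -> A w x s = A w' x s.
Proof.
move=> ww Ds; apply: (deg_lt_ind (submod_eq (A w x) (A w' x)) Ds) => m mk /=.
have sl : submodule [set x | A w x (mon m) = A w' x (mon m)].
  split=> [|a u v /= hu hv]; last by rewrite !AlP hu hv.
  have A0 v : A v 0 (mon m) = 0.
    by have := AlP v (-1) 0 0 (mon m); rewrite scaler0 addr0 scaleN1r addNr.
  by rewrite /= !A0.
by apply: (basis_ind sl) => i; rewrite /= !AU ww.
Qed.

(** Letters are prepended freely in increasing order.  For j < i and j <= N the
    bracket relation of [b i] and [b j] on [N] forces the action of [b i] on
    j N, hence the correction.  It only involves corrections in degrees at most
    that of N, one less than the degree of j N; the fuel [d] bounds the
    degree. *)
Fixpoint corr_upto (d : nat) i m : S :=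
  if d is d'.+1 then
    if least le m is Some j then
      let N := divcm m (ucm j) in
      if le i j then 0
      else A (corr_upto d') (b j) (corr_upto d' i N)
           + A (corr_upto d') (lie (b i) (b j)) (mon N)
    else 0
  else 0.

Lemma corr_uptoS d i m : corr_upto d.+1 i m =
  if least le m is Some j then
    if le i j then 0
    else A (corr_upto d) (b j) (corr_upto d i (divcm m (ucm j)))
         + A (corr_upto d) (lie (b i) (b j)) (mon (divcm m (ucm j)))
  else 0.
Proof. by []. Qed.

Lemma corr_upto1 d i : corr_upto d i mone = 0.
Proof. by case: d => // d; rewrite corr_uptoS least1. Qed.

Lemma corr_uptoM d i j N : below le j N ->
  corr_upto d.+1 i (ucm j ** N) = if le i j then 0 else
    A (corr_upto d) (b j) (corr_upto d i N)
    + A (corr_upto d) (lie (b i) (b j)) (mon N).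
Proof. by move=> jN; rewrite corr_uptoS (leastM leT jN) mulcmK. Qed.

(** The value is independent of the fuel as soon as there is enough of it.  This
    must be proved together with the degree bound, which ensures that nested
    corrections are only evaluated in lower degree. *)
Lemma corr_upto_stable d m : (mdeg m <= d)%N ->
  (forall i, deg_lt (mdeg m).+1 (corr_upto d i m)) /\
  (forall i, corr_upto d.+1 i m = corr_upto d i m).
Proof.
elim: d m => [|d IHd] m.
  rewrite leqn0 => /eqP/mdeg_eq0I ->; split=> i; rewrite ?corr_upto1 //.
  exact: submod0 (deg_lt_submod _).
have [->|[j [N [jN ->]]]] := cmonom_cases leT m.
  split=> i; rewrite ?corr_upto1 //; exact: submod0 (deg_lt_submod _).
rewrite mdegUM ltnS => Nd.
have low n : (mdeg n < (mdeg N).+1)%N -> (mdeg n <= d)%N.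
  by rewrite ltnS => nN; exact: leq_trans Nd.
have dN : deg_lt (mdeg N).+1 (mon N : S) by exact: deg_ltU.
split=> i; rewrite !(corr_uptoM _ _ jN); case: (le i j).
- exact: submod0 (deg_lt_submod _).
- apply: (submodD (deg_lt_submod _)); apply: act_with_deg.
  + by move=> k n /low/IHd[].
  + exact: (IHd _ Nd).1.
  + by move=> k n /low/IHd[].
  + exact: dN.
- by [].
- have eqd k n : (mdeg n < (mdeg N).+1)%N ->
      corr_upto d.+1 k n = corr_upto d k n by move=> /low/IHd[].
  rewrite (IHd _ Nd).2 (act_with_eq _ eqd dN).
  by rewrite (act_with_eq _ eqd ((IHd _ Nd).1 i)).
Qed.

Definition corr i m := corr_upto (mdeg m) i m.

Lemma corr_uptoE d i m : (mdeg m <= d)%N -> corr_upto d i m = corr i m.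
Proof.
move=> md; rewrite -(subnK md); elim: (d - mdeg m)%N => // k IHk.
by rewrite addSn (corr_upto_stable _).2 ?IHk // leq_addl.
Qed.

Lemma corr_deg i m : deg_lt (mdeg m).+1 (corr i m).
Proof. exact: (corr_upto_stable (leqnn _)).1. Qed.

Definition pbw_act : L -> {linear S -> S} := A corr.

Lemma pbw_act_deg k x s : deg_lt k s -> deg_lt k.+1 (pbw_act x s).
Proof. by apply: act_with_deg => i m _; exact: corr_deg. Qed.

Lemma pbw_actU i m : pbw_act (b i) (mon m) = mon (ucm i ** m) + corr i m.
Proof. exact: AU. Qed.

Lemma pbw_actPl a x y s :
  pbw_act (a *: x + y) s = a *: pbw_act x s + pbw_act y s.
Proof. exact: AlP. Qed.

Lemma corr_below i m : below le i m -> corr i m = 0.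
Proof.
have [->|[j [N [jN ->]]]] := cmonom_cases leT m.
  by rewrite /corr corr_upto1.
move=> /(_ j); rewrite cmM cmUU => /(_ isT) ij.
by rewrite /corr mdegUM corr_uptoM // ij.
Qed.

Lemma pbw_act_below i m : below le i m -> pbw_act (b i) (mon m) = mon (ucm i ** m).
Proof. by move=> im; rewrite pbw_actU corr_below ?addr0. Qed.

Lemma pbw_act_swap i j N : below le j N -> ~~ le i j ->
  pbw_act (b i) (mon (ucm j ** N)) =
  pbw_act (b j) (pbw_act (b i) (mon N)) + pbw_act (lie (b i) (b j)) (mon N).
Proof.
move=> jN ij; have ji : le j i.
  by case: leT => _ /(_ i j); rewrite (negPf ij).
have bij : below le j (ucm i ** N) by apply: belowM => //; exact: belowU.
have low k n : (mdeg n < (mdeg N).+1)%N -> corr_upto (mdeg N) k n = corr k n.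
  by rewrite ltnS; exact: corr_uptoE.
have dN : deg_lt (mdeg N).+1 (mon N : S) by exact: deg_ltU.
rewrite (pbw_actU i (ucm j ** N)) (pbw_actU i N) (linearD (pbw_act (b j))).
rewrite (pbw_act_below bij) /corr mdegUM (corr_uptoM _ _ jN) (negPf ij).
rewrite (act_with_eq _ low dN) -/(corr i N).
rewrite (act_with_eq _ low (@corr_deg i N)) -addrA.
by rewrite mulmA (mulmC (ucm i)) -mulmA.
Qed.

Lemma pbw_act0l s : pbw_act 0 s = 0.
Proof.
by have := pbw_actPl (-1) 0 0 s; rewrite scaler0 addr0 scaleN1r addNr.
Qed.

Lemma pbw_actNl x s : pbw_act (- x) s = - pbw_act x s.
Proof. by rewrite -scaleN1r -[_ *: x]addr0 pbw_actPl pbw_act0l addr0 scaleN1r. Qed.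

Lemma pbw_actDl x y s : pbw_act (x + y) s = pbw_act x s + pbw_act y s.
Proof. by rewrite -[x]scale1r pbw_actPl !scale1r. Qed.

Definition bracket_at x y s : Prop :=
  pbw_act x (pbw_act y s) = pbw_act y (pbw_act x s) + pbw_act (lie x y) s.

Lemma bracket_at_submod x y : submodule (bracket_at x y).
Proof.
split=> [|a s t]; rewrite /bracket_at ?linear0 ?addr0 // => hs ht.
by rewrite !linearP /= hs ht scalerDr addrACA.
Qed.

Lemma bracket_at_sym x y s : bracket_at x y s -> bracket_at y x s.
Proof. by rewrite /bracket_at lieC pbw_actNl => ->; rewrite subrK. Qed.

Lemma bracket_at_submodl y s : submodule [set x | bracket_at x y s].
Proof.
split=> [|a x x' /= hx hx']; rewrite /= /bracket_at.
  by rewrite lieC linear0 oppr0 !pbw_act0l linear0 addr0.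
by rewrite lie_linearl !pbw_actPl hx hx' linearP /= scalerDr addrACA.
Qed.

Lemma bracket_at_basis s :
  (forall i j, bracket_at (b i) (b j) s) -> forall x y, bracket_at x y s.
Proof.
move=> h x y; move: x; apply: basis_ind (bracket_at_submodl y s) _ => i.
apply: bracket_at_sym; move: y; apply: basis_ind (bracket_at_submodl _ s) _ => j.
exact: h.
Qed.

(** When j precedes the letters of m, the bracket relation is the rule that
    defines the action of [b i] on j m. *)
Lemma bracket_at_below i j m : below le j m -> ~~ le i j ->
  bracket_at (b i) (b j) (mon m).
Proof.
by move=> jm ij; rewrite /bracket_at -pbw_act_swap // (pbw_act_below jm).
Qed.

(** One half of the inductive step of the bracket relation.  For k smaller than i
    and j, write k N as [b k] acting on N and move [b k] to the left through
    [b j] and [b i].  The middle terms are symmetric in i and j, so they cancel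
    in the commutator, and the last terms are matched by the Jacobi identity. *)
Lemma bracket_jacobi_half i j k N : below le k N -> ~~ le i k -> ~~ le j k ->
  (forall x y s, deg_lt (mdeg N).+1 s -> bracket_at x y s) ->
  pbw_act (b i) (pbw_act (b j) (mon (ucm k ** N))) =
    pbw_act (b k) (pbw_act (b i) (pbw_act (b j) (mon N)))
    + (pbw_act (lie (b i) (b k)) (pbw_act (b j) (mon N))
       + pbw_act (lie (b j) (b k)) (pbw_act (b i) (mon N)))
    + pbw_act (lie (b i) (lie (b j) (b k))) (mon N).
Proof.
move=> kN ik jk IH; set z := mon N.
have dz : deg_lt (mdeg N).+1 z by exact: deg_ltU.
have kj : le k j by case: leT => _ /(_ k j); rewrite (negPf jk) orbF.
rewrite -(pbw_act_below kN) -/z (IH (b j) (b k) _ dz) linearD /=.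
have -> : pbw_act (b i) (pbw_act (b k) (pbw_act (b j) (mon N))) =
    pbw_act (b k) (pbw_act (b i) (pbw_act (b j) (mon N)))
    + pbw_act (lie (b i) (b k)) (pbw_act (b j) (mon N)).
  suff : bracket_at (b i) (b k) (pbw_act (b j) (mon N)) by [].
  rewrite pbw_actU; apply: (submodD (bracket_at_submod _ _)).
    by apply: bracket_at_below => //; apply: belowM => //; exact: belowU.
  by apply: IH; exact: corr_deg.
by rewrite (IH (b i) (lie (b j) (b k)) z dz) !addrA.
Qed.

Fact jacobi_shuffle (V : zmodType) (u v w z x y : V) :
  u + v + (w + z) + (x + y) = u + (z + w) + x + (v + y).
Proof. by rewrite [LHS](AC ((2*2)*2) ((1*(4*3))*5*(2*6)))%AC. Qed.

(** Letters preceding every letter of m are covered by the definition of the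
    action; otherwise the first letter k of m precedes both i and j. *)
Lemma bracket_step (n : nat) : (forall x y s, deg_lt n s -> bracket_at x y s) ->
  forall m i j, (mdeg m < n.+1)%N -> ~~ le i j -> bracket_at (b i) (b j) (mon m).
Proof.
move=> IH m i j mn ij.
have ji : le j i by case: leT => _ /(_ i j); rewrite (negPf ij).
have [mE|[k [N [kN mE]]]] := cmonom_cases leT m; rewrite mE in mn *.
  by apply: bracket_at_below => //; exact: below1.
have [[[le_refl le_trans] _] le_total] := leT.
have [jk|jk] := boolP (le j k).
  apply: bracket_at_below => //; apply: belowM; first exact: belowU.
  exact: below_trans kN.
have ik : ~~ le i k by apply: contra jk; exact: le_trans.
have {}IH x y s : deg_lt (mdeg N).+1 s -> bracket_at x y s.
  by move=> Ds; apply: IH; apply: deg_ltW Ds; rewrite mdegUM ltnS in mn.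
have dz : deg_lt (mdeg N).+1 (mon N : S) by exact: deg_ltU.
rewrite /bracket_at !(bracket_jacobi_half kN) // (IH (b i) (b j) _ dz).
rewrite linearD /= -(pbw_act_below kN).
rewrite (bracket_at_sym (IH (b k) (lie (b i) (b j)) _ dz)).
have -> : lie (b i) (lie (b j) (b k)) =
    lie (b j) (lie (b i) (b k)) + lie (lie (b i) (b j)) (b k).
  have := lie_jacobi (b i) (b j) (b k).
  rewrite (lieC (b k) (b i)) linearN /= (lieC (lie (b i) (b j)) (b k)) => /eqP.
  by rewrite addr_eq0 => /eqP <-; rewrite addrC subrK.
by rewrite pbw_actDl; exact: jacobi_shuffle.
Qed.

Lemma pbw_act_bracket x y s : bracket_at x y s.
Proof.
suff h (n : nat) : forall x y s, deg_lt n s -> bracket_at x y s.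
  exact: h (@deg_lt_msize K I s).
elim: n => [|n IHn] {}x {}y {}s Ds.
  have -> : s = 0 by apply/malgP => m; rewrite mcoeff0 Ds.
  exact: submod0 (bracket_at_submod x y).
apply: (deg_lt_ind (bracket_at_submod x y) Ds) => m mn.
apply: bracket_at_basis => i j; have [-> |ij] := eqVneq i j.
  by rewrite /bracket_at lie_alt pbw_act0l addr0.
have [lij|lij] := boolP (le i j); last exact: (bracket_step IHn).
apply: bracket_at_sym; apply: (bracket_step IHn) => //.
case: leT => -[_ anti] _; apply: contra ij => lji; apply/eqP/anti.
by rewrite lij.
Qed.

End PBW.

(** The properties of the action on which the Poincare-Birkhoff-Witt theorem
    rests. *)
Record pbw_action (K : comNzRingType) (L : lieType K) (I : choiceType)
    (b : I -> L) (le : rel I)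
    (act : L -> {linear {malg K[{cmonom I}]} -> {malg K[{cmonom I}]}}) : Prop := {
  pbw_linear : forall a x y s, act (a *: x + y) s = a *: act x s + act y s;
  pbw_below : forall i m, below le i m -> act (b i) (mon K m) = mon K (ucm i ** m);
  pbw_swap : forall i j m, below le j m -> ~~ le i j ->
    act (b i) (mon K (ucm j ** m)) =
    act (b j) (act (b i) (mon K m)) + act (lie (b i) (b j)) (mon K m);
  pbw_deg : forall n x s, deg_lt n s -> deg_lt n.+1 (act x s);
  pbw_low : forall i m,
    deg_lt (mdeg m).+1 (act (b i) (mon K m) - mon K (ucm i ** m));
  pbw_lie : forall x y s, act (lie x y) s = act x (act y s) - act y (act x s)
}.

Lemma pbw_action_exists (K : comNzRingType) (L : lieType K) (I : choiceType)
    (b : I -> L) (c : {linear L -> {malg K[I]}}) (le : rel I) :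
  (forall x, lext b (c x) = x) -> (forall i, c (b i) = << i >>) ->
  total_order le -> exists act, pbw_action b le act.
Proof.
move=> cK cE leT; have [A [AlP AU]] := act_with_exists cE.
exists (pbw_act b le A); split=> [a x y s|i m im|i j m jm ij|n x s Ds|i m|x y s].
- exact: pbw_actPl.
- exact: (pbw_act_below leT AU im).
- exact: (pbw_act_swap cK leT AlP AU jm ij).
- exact: (pbw_act_deg cK leT AlP AU x Ds).
- rewrite (pbw_actU le AU) addrC addKr.
  exact: (@corr_deg _ _ _ _ _ cK _ leT _ AlP AU).
- have h : bracket_at b le A x y s by exact: (pbw_act_bracket cK leT AlP AU).
  by rewrite h addrC addKr.
Qed.

(** * Enveloping algebras over a field are domains *)

Section PBWTheorem.
Variables (K : comNzRingType) (L : lieType K).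
Variables (I : choiceType) (b : I -> L) (c : {linear L -> {malg K[I]}}).
Hypothesis cK : forall x, lext b (c x) = x.
Variable le : rel I.
Hypothesis leT : total_order le.
Variables (U : algType K) (iL : {linear L -> U}).
Hypothesis UP : enveloping iL.
Notation S := {malg K[{cmonom I}]}.
Notation mon := (@mon K I).
Variable act : L -> {linear S -> S}.
Hypothesis actP : pbw_action b le act.
Implicit Types (s t : S) (x y : L) (i j : I) (m n N : {cmonom I}).

Lemma act0 s : act 0 s = 0.
Proof.
by have := pbw_linear actP (-1) 0 0 s; rewrite scaler0 addr0 scaleN1r addNr.
Qed.

(** Ordered monomials in [U]; the fuel [d] bounds the degree. *)
Fixpoint omon_upto (d : nat) m : U :=
  if d is d'.+1 then
    if least le m is Some j then iL (b j) * omon_upto d' (divcm m (ucm j)) else 1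
  else 1.

Definition omon m := omon_upto (mdeg m) m.

Lemma omon1 : omon mone = 1.
Proof. by rewrite /omon mdeg1. Qed.

Lemma omonM j N : below le j N -> omon (ucm j ** N) = iL (b j) * omon N.
Proof. by move=> jN; rewrite /omon mdegUM /= leastM // mulcmK. Qed.

Definition quantize : S -> U := lext omon.
HB.instance Definition _ := GRing.Linear.on quantize.

Lemma quantizeU m : quantize (mon m) = omon m.
Proof. exact: lext_mon. Qed.

Lemma quantize_act_submod x : submodule [set s | quantize (act x s) = iL x * quantize s].
Proof.
split=> [|a s t /= hs ht] /=; first by rewrite !linear0 mulr0.
by rewrite !linearP /= hs ht mulrDr -scalerAr.
Qed.

Lemma quantize_act_submodl s : submodule [set x | quantize (act x s) = iL x * quantize s].
Proof.
split=> [|a x y /= hx hy] /=; first by rewrite act0 !linear0 mul0r.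
by rewrite (pbw_linear actP) !linearP /= hx hy mulrDl -scalerAl.
Qed.

Lemma quantize_act_below i m : below le i m ->
  quantize (act (b i) (mon m)) = iL (b i) * quantize (mon m).
Proof. by move=> im; rewrite (pbw_below actP im) !quantizeU omonM. Qed.

(** Reordering a product in [U] follows the same rule as the recursion that
    defines the action, so sending a monomial to the corresponding ordered
    product intertwines the action with left multiplication. *)
Lemma quantize_act x s : quantize (act x s) = iL x * quantize s.
Proof.
suff h d : forall x s, deg_lt d s -> quantize (act x s) = iL x * quantize s.
  exact: h (@deg_lt_msize K I s).
elim: d => [|d IHd] {}x {}s Ds.
  have -> : s = 0 by apply/malgP => m; rewrite mcoeff0 Ds.
  by rewrite !linear0 mulr0.
apply: (deg_lt_ind (quantize_act_submod x) Ds) => m md /=.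
rewrite -[x]cK; apply: (malg_ind (N := [set g |
  quantize (act (lext b g) (mon m)) = iL (lext b g) * quantize (mon m)])).
  exact: (submod_preim (lext b)) (quantize_act_submodl _).
move=> i _ /=; rewrite lextU.
have [->|[j [N [jN mE]]]] := cmonom_cases leT m.
  by apply: quantize_act_below; exact: below1.
rewrite mE in md *; rewrite mdegUM ltnS in md.
have [ij|ij] := boolP (le i j).
  apply: quantize_act_below; apply: belowM; first exact: belowU.
  exact: below_trans jN.
have ji : le j i by case: leT => _ /(_ i j); rewrite (negPf ij).
have dN : deg_lt d ((mon N) : S) by exact: deg_ltU.
rewrite (pbw_swap actP jN ij) linearD /= [quantize (act (lie _ _) _)]IHd //.
have -> : quantize (act (b j) (act (b i) (mon N))) =
    iL (b j) * (iL (b i) * quantize (mon N)).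
  rewrite -IHd //; set z := mon (ucm i ** N); set w := act (b i) (mon N).
  have [v wv vd] : exists2 v, w = z + v & deg_lt d v.
    exists (w - z); first by rewrite addrC subrK.
    by apply: (deg_ltW md); exact: (pbw_low actP).
  rewrite wv !linearD /= mulrDr (IHd _ _ vd) quantize_act_below //.
  by apply: belowM => //; exact: belowU.
rewrite !quantizeU omonM // (proj1 UP) mulrBl !mulrA.
by rewrite addrC subrK.
Qed.

Variable r : U -> S -> S.
Hypotheses (rr : representation r) (rE : forall x s, r (iL x) s = act x s).

Lemma quantize_rep u s : quantize (r u s) = u * quantize s.
Proof.
have [eps _] := enveloping_aug UP.
apply: (intertwine eps (enveloping_dense UP) rr (regular_rep U)) => x t.
by rewrite rE /= quantize_act.
Qed.

(** Consequently u is recovered from its action on 1: the ordered monomials span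
    [U], and u |-> u.1 is injective. *)
Lemma quantize_rep1 u : quantize (r u (mon mone)) = u.
Proof. by rewrite quantize_rep quantizeU omon1 mulr1. Qed.

Lemma rep_omon m n :
  deg_lt (mdeg m + mdeg n) (r (omon m) (mon n) - (mon (m ** n))).
Proof.
move: m; apply: (cmonom_ind leT) => [|j N jN IH].
  have [_ _ r1 _] := rr; rewrite omon1 r1 mul1m subrr.
  exact: submod0 (deg_lt_submod _).
have [_ _ _ rM] := rr; rewrite omonM // rM rE.
set w := _ - _ in IH.
have -> : r (omon N) (mon n) = (mon (N ** n)) + w by rewrite addrC subrK.
rewrite linearD /= mdegUM addSn -mulmA addrAC.
apply: (submodD (deg_lt_submod _)); last exact: (pbw_deg actP).
by rewrite -mdegM; exact: (pbw_low actP).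
Qed.

(** So u |-> u.1 identifies the associated graded ring of [U] with the polynomial
    ring: an ordered monomial acts on a monomial by multiplication, up to lower
    degree. *)
Lemma rep_quantize d e s t : deg_lt d.+1 s -> deg_lt e.+1 t ->
  deg_lt (d + e) (r (quantize s) t - s * t).
Proof.
move=> Ds Dt; have sD := @deg_lt_submod K I (d + e).
have [rl rl' _ _] := rr.
apply: (deg_lt_ind _ Ds (N := [set s | deg_lt (d + e) (r (quantize s) t - s * t)])).
  split=> [|a u v /= hu hv] /=.
    by rewrite linear0 (rep0l _ rr) mul0r subrr; exact: sD.1.
  rewrite linearP rl' mulrDl -scalerAl opprD addrACA -scalerBr.
  exact: (sD.2 a _ _ hu hv).
move=> m md /=; rewrite quantizeU.
apply: (deg_lt_ind _ Dt (N := [set t | deg_lt (d + e) (r (omon m) t - (mon m) * t)])).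
  split=> [|a u v /= hu hv] /=.
    by rewrite (rep0 _ rr) mulr0 subrr; exact: sD.1.
  rewrite rl mulrDr -scalerAr opprD addrACA -scalerBr.
  exact: (sD.2 a _ _ hu hv).
move=> n nd /=; rewrite -monM.
have le_mn : (mdeg m + mdeg n <= d + e)%N by rewrite leq_add // -ltnS.
by apply: (deg_ltW le_mn); exact: rep_omon.
Qed.

End PBWTheorem.

Section LeadingMonomial.
Variables (I : choiceType) (le : rel I).
Hypothesis leT : total_order le.
Implicit Types (m n p : {cmonom I}).

(** A total order on monomials refining the degree and compatible with products,
    which makes a product of leading monomials leading. *)
Definition mlt m n : Prop := (mdeg m < mdeg n)%N \/
  mdeg m = mdeg n /\
  exists i, (m i < n i)%N /\ forall j, ~~ le i j -> m j = n j.

Lemma mlt_irr m : ~ mlt m m.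
Proof. by case=> [|[_ [i []]]]; rewrite ltnn. Qed.

Lemma mlt_trans m n p : mlt m n -> mlt n p -> mlt m p.
Proof.
have [[[refl trans] anti] tot] := leT.
case=> [mn|[mn [i [mni hi]]]] [np|[np [k [npk hk]]]].
- by left; exact: ltn_trans np.
- by left; rewrite -np.
- by left; rewrite mn.
right; split; first by rewrite mn.
have [ik|ik] := boolP (le i k).
  have [ki|ki] := boolP (le k i).
    have e : i = k by apply: anti; rewrite ik.
    rewrite -{}e in npk hk; exists i; split; first exact: ltn_trans npk.
    by move=> j ij; rewrite hi // hk.
  exists i; split; first by rewrite -(hk i ki).
  move=> j ij; rewrite hi // hk //; apply: contra ij; exact: trans.
have ki : le k i by have := tot i k; rewrite (negPf ik).
exists k; split; first by rewrite hi.
by move=> j kj; rewrite hi ?hk //; apply: contra kj; exact: trans.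
Qed.

Lemma mlt_total m n : m <> n -> mlt m n \/ mlt n m.
Proof.
have [[[refl trans] anti] tot] := leT.
move=> mn; case: (ltngtP (mdeg m) (mdeg n)) => [d|d|d].
- by left; left.
- by right; left.
pose D := [seq i <- enum_fset (finsupp m `|` finsupp n)%fset | m i != n i].
have DE i : (i \in D) = (m i != n i).
  rewrite mem_filter; case: eqP => //= /eqP h.
  rewrite -[_ \in _]/(i \in (finsupp m `|` finsupp n)%fset) in_fsetU.
  rewrite -!cmE_neq0; apply: contraR h; rewrite negb_or !negbK.
  by move=> /andP[/eqP -> /eqP ->].
have [|||i iD imin] := @seq_greatest _ (fun i j => le j i && (i != j)) D.
- move=> x y z /andP[yx nxy] /andP[zy nyz]; rewrite (trans _ _ _ zy yx) /=.
  apply/eqP => xz; move/eqP: nxy; apply; apply: anti.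
  by rewrite yx xz zy.
- move=> x y /eqP xy; case/orP: (tot x y) => h; [right|left].
    by rewrite h eq_sym.
  by rewrite h.
- apply/eqP => D0; apply: mn; apply/eqP/cmP => i; apply/eqP.
  by apply: contraT; rewrite -DE D0.
have hj j : ~~ le i j -> m j = n j.
  move=> ij; apply/eqP; apply: contraR ij; rewrite -DE => /imin[->|/andP[]//].
  exact: refl.
move: iD; rewrite DE neq_ltn => /orP[h|h]; [left|right]; right; split => //.
  by exists i.
by exists i; split => // j /hj.
Qed.

Lemma mlt_mul m n p : mlt m n -> mlt (m ** p) (n ** p).
Proof.
case=> [mn|[mn [i [mni hi]]]]; [left|right]; rewrite !mdegM.
  by rewrite ltn_add2r.
split; first by rewrite mn.
by exists i; split=> [|j ij]; rewrite !cmM ?ltn_add2r // hi.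
Qed.

Lemma mlt_mul2 m n p p' : m = n \/ mlt m n -> mlt p p' -> mlt (m ** p) (n ** p').
Proof.
move=> mn pp; have h : mlt (m ** p) (m ** p').
  by rewrite (mulmC m p) (mulmC m p'); exact: mlt_mul.
by case: mn => [<-//|mn]; apply: mlt_trans h _; exact: mlt_mul.
Qed.

Lemma mlt_mul2r m n p p' : mlt p p' -> m = n \/ mlt m n -> mlt (p ** m) (p' ** n).
Proof.
move=> pp mn; have h := mlt_mul2 mn pp.
have h' : mlt (p ** m) (n ** p') by case: _ / (mulmC m p).
by case: _ / (mulmC n p').
Qed.

Variable K : comNzRingType.
Notation S := {malg K[{cmonom I}]}.

Lemma leading_monomial (s : S) : s <> 0 -> exists m, [/\ m \in msupp s,
  deg_lt (mdeg m).+1 s & forall n, n \in msupp s -> n = m \/ mlt n m].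
Proof.
move=> s0; have [|||m ms mP] := @seq_greatest _ mlt (msupp s).
- exact: mlt_trans.
- exact: mlt_total.
- apply/eqP => h; apply: s0; apply/malgP => i; rewrite mcoeff0.
  by apply: mcoeff_outdom; rewrite -[_ \in _]/(i \in enum_fset _) h.
exists m; split => // n mn; apply: mcoeff_outdom; apply/negP => /mP[nm|].
  by rewrite nm ltnn in mn.
by case=> [|[e _]]; [rewrite ltnNge ltnW|rewrite e ltnn in mn].
Qed.

Lemma leading_coeff_mul (s t : S) m n :
  (forall p, p \in msupp s -> p = m \/ mlt p m) ->
  (forall p, p \in msupp t -> p = n \/ mlt p n) ->
  m \in msupp s -> n \in msupp t -> (s * t)@_(m ** n) = s@_m * t@_n.
Proof.
move=> mmax nmax ms nt.
have inner : \sum_(p <- (msupp t `\ n)%fset)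
    (s@_m * t@_p) *+ (m ** p == m ** n) = 0.
  rewrite big_seq big1 // => p; rewrite in_fsetD1 => /andP[pn /nmax[pe|pl]].
    by rewrite pe eqxx in pn.
  case: (m ** p =P m ** n) => // pp; case: (@mlt_irr (m ** n)).
  by have := mlt_mul2 (or_introl (erefl m)) pl; rewrite pp.
have outer : \sum_(p <- (msupp s `\ m)%fset) \sum_(p' <- msupp t)
    (s@_p * t@_p') *+ (p ** p' == m ** n) = 0.
  rewrite big_seq big1 // => p; rewrite in_fsetD1 => /andP[pm /mmax[pe|pl]].
    by rewrite pe eqxx in pm.
  rewrite big_seq big1 // => p' /nmax p'n.
  have lt_pp : mlt (p ** p') (m ** n) by exact: mlt_mul2r.
  case: (p ** p' =P m ** n) => // pp; case: (@mlt_irr (m ** n)).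
  by case: _ / pp lt_pp.
rewrite mcoeffMl (big_fsetD1 m ms) outer (big_fsetD1 n nt) inner eqxx.
by rewrite mulr1n /= !addr0.
Qed.

End LeadingMonomial.

(** If u v = 0 with u and v nonzero, then u and v have nonzero symbols u.1 and
    v.1, whose product has lower degree than the sum of their degrees, whereas
    the leading coefficient of that product is nonzero. *)
Theorem enveloping_domain (K : comNzRingType) (L : lieType K) (U : algType K)
    (iL : {linear L -> U}) :
  (forall a : K, a != 0 -> exists b : K, b * a = 1) -> enveloping iL ->
  GRing.integral_domain_axiom U.
Proof.
move=> fieldK UP u v uv.
have [I [b [c [cK cE]]]] := basis_exists L fieldK.
have [le /well_order_total leT] := well_ordering_principle I.
have [act actP] := pbw_action_exists cK cE leT.
have [|||r [rr rE]] := enveloping_rep UP (f := fun x s => act x s).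
- by move=> x; exact: linearP.
- by move=> s a x y; exact: pbw_linear actP a x y s.
- exact: pbw_lie actP.
have sK := quantize_rep1 cK leT UP actP rr rE.
apply: contrapT => /negP; rewrite negb_or => /andP[u0 v0].
have rep_neq0 w : w != 0 -> r w (mon K mone) <> 0.
  by move=> w0 /(congr1 (quantize b le iL)); rewrite sK linear0; exact/eqP.
have [m [ms md mmax]] := leading_monomial leT (rep_neq0 _ u0).
have [n [ns nd nmax]] := leading_monomial leT (rep_neq0 _ v0).
have := rep_quantize leT actP rr rE md nd; rewrite sK.
have [_ _ _ rM] := rr; rewrite -rM uv rep0l // sub0r.
move=> /(_ (m ** n)); rewrite mdegM leqnn => /(_ isT).
rewrite mcoeffN (leading_coeff_mul leT mmax nmax ms ns) => /eqP.
rewrite oppr_eq0 => /eqP mn0.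
have [a am] := fieldK _ (etrans (mcoeff_neq0 _ _) ms).
move: ns; rewrite -mcoeff_neq0 => /eqP; apply.
by rewrite -[LHS]mul1r -am -mulrA mn0 mulr0.
Qed.

(** * Residual nilpotence of F/M and of the augmentation filtration of U(L) *)

Lemma bigcap_submod0 (K : comNzRingType) (V : lmodType K) (N : nat -> set V) :
  (forall n, submodule (N n)) ->
  \bigcap_(n in [set n | (1 <= n)%N]) N n = [set 0] <->
  forall u, (forall n, N n.+1 u) -> u = 0.
Proof.
move=> sN; split=> [N0 u Nu|N0].
  suff : (\bigcap_(n in [set n | (1 <= n)%N]) N n) u by rewrite N0.
  by case.
apply/seteqP; split=> u => [Nu|-> n _]; last exact: submod0.
by apply: N0 => n; exact: Nu.
Qed.

Theorem theorem5p5 (K : comNzRingType)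
    (F : lieType K) (hF : free_lie F) (hFab : ~ abelian_lie F)
    (R : set F) (hR : lie_ideal R) (hR0 : R <> [set 0])
    (L : lieType K) (p : {linear F -> L}) (hp : lie_quotient R p)
    (UF : algType K) (iF : {linear F -> UF}) (hUF : enveloping iF)
    (UL : algType K) (iL : {linear L -> UL}) (hUL : enveloping iL)
    (Lt : lieType K) (q : {linear F -> Lt}) (hq : lie_quotient (Mset iF R) q) :
  [/\
    (* (i) *)
    \bigcap_(n in [set n | (1 <= n)%N]) idealX (augmentation iL) n = [set 0] ->
    \bigcap_(n in [set n | (1 <= n)%N]) lower_central Lt n = [set 0],
    (* (ii) *)
    \bigcap_(n in [set n | (1 <= n)%N]) lower_central Lt n = [set 0] ->
    (forall (V : lmodType UL^c) (e : {additive V -> Lt}),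
      adjoint_module iL p q R e ->
      annihilator V = [set 0] ->
      \bigcap_(n in [set n | (1 <= n)%N]) idealX (augmentation iL) n = [set 0]),
    (* (iii) *)
    GRing.integral_domain_axiom UL ->
    (\bigcap_(n in [set n | (1 <= n)%N]) idealX (augmentation iL) n = [set 0] <->
     \bigcap_(n in [set n | (1 <= n)%N]) lower_central Lt n = [set 0])
    & (* the example in (iii) *)
    (forall a : K, a != 0 -> exists b : K, b * a = 1) ->
    GRing.integral_domain_axiom UL].
Proof.
have [X [j Fj]] := hF.
have [pi piE] := enveloping_map hp hUF hUL.
have [D DP] := fox_derivative Fj hUF.
have D1 x : D x 1 = 0 by have [] := DP x.
have DE x y u : D x (iF (j y) * u) = if `[< x = y >] then u else 0.
  by have [_ ->] := DP x.
have resL := bigcap_submod0 (fun n => idealX_submod n (augmentation_ideal iL)).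
have resLt := bigcap_submod0 (lower_central_submod Lt).
have part1 :
    \bigcap_(n in [set n | (1 <= n)%N]) idealX (augmentation iL) n = [set 0] ->
    \bigcap_(n in [set n | (1 <= n)%N]) lower_central Lt n = [set 0].
  move=> /resL L0; apply/resLt.
  exact: (residual_lower_central Fj hR hp hUF hUL hq piE DE L0).
split=> [//|/resLt Lt0 V e eV annV|domUL|fieldK].
- apply/resL => u Iu; suff : annihilator V u by rewrite annV.
  move=> v /=; have [einj _ _ _] := eV; apply: einj; rewrite raddf0.
  apply: Lt0 => n.
  exact: lower_centralS (adjoint_lower_central hp hUL eV v (Iu n)).
- split=> [|/resLt Lt0]; first exact: part1.
  apply/resL.
  exact: (residual_augmentation Fj hR hp hUF hUL hq piE D1 DE domUL Lt0).
- exact: enveloping_domain fieldK hUL.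
Qed.
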